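(* Let $0\le i\le q^d-2$. For every $y\in\mathbb Z_p$ one has the equality of power series $$s_X\big(\Theta_\infty(X,\widetilde\omega_{\mathfrak p}^{-i})\big)(y)=L_{\mathfrak p}(X,-y,\omega_{\mathfrak p}^i)$$ in $A_{\mathfrak p}[[X]]$.
   Context: Setting. $\mathbb F$ is a finite field with $q\ge 3$ elements and characteristic $p$. $A=\mathbb F[\theta]$, $F=\mathbb F(\theta)$, $\infty$ is the place of $F$ corresponding to $1/\theta$, $\mathfrak p$ is a nonzero prime ideal of $A$ of degree $d$, $S=\{\mathfrak p,\infty\}$; $A_{+,n}$ is the set of monic polynomials of degree $n$ in $A$. $A_{\mathfrak p}$ is the completion of $A$ at $\mathfrak p$, $\mathbb F_{\mathfrak p}=A/\mathfrak p$ its residue field, regarded as a subring of $A_{\mathfrak p}$ by lifting nonzero elements to roots of unity. $U_1=1+\mathfrak pA_{\mathfrak p}$. For $u\in U_1$, $y\in\mathbb Z_p$: $u^y=\sum_{n\ge0}\binom yn(u-1)^n$. $\Phi$ is the Carlitz module ($\Phi_\theta=\theta\tau^0+\tau$ in $F\{\tau\}$, $\tau f=f^q\tau$), $\Phi[\mathfrak a]$ its $\mathfrak a$-torsion, $F_n=F(\Phi[\mathfrak p^{n+1}])$, $\mathcal F=\bigcup_nF_n$. $\mathrm{Gal}(\mathcal F/F)=G_\infty=\Delta\times\Gamma$ with $\Gamma=\mathrm{Gal}(\mathcal F/F_0)$ and $\Delta\simeq\mathrm{Gal}(F_0/F)$ cyclic of order $q^d-1$. Extending $\Phi$ to a formal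 Drinfeld module over $A_{\mathfrak p}$, the cyclotomic character $\kappa:G_\infty\to A_{\mathfrak p}^*$ is the isomorphism with $\sigma(\varepsilon)=\Phi_{\kappa(\sigma)}(\varepsilon)$ for all $\varepsilon\in\Phi[\mathfrak p^\infty]$; it maps $\Gamma$ onto $U_1$. Characters. $\omega_{\mathfrak p}:A\to\mathbb F_{\mathfrak p}\hookrightarrow A_{\mathfrak p}$ is reduction mod $\mathfrak p$ followed by the lift; for $a\in A-\mathfrak p$ write $a=\omega_{\mathfrak p}(a)\langle a\rangle_{\mathfrak p}$ with $\langle a\rangle_{\mathfrak p}\in U_1$. $W$ is the Witt ring of $\mathbb F_{\mathfrak p}$ (so $W/pW=\mathbb F_{\mathfrak p}$). $\widetilde\omega_{\mathfrak p}:\Delta\to W^*$ is the composition of $\kappa|_\Delta:\Delta\to\mathbb F_{\mathfrak p}^*$ with the Teichmüller lift $\mathbb F_{\mathfrak p}^*\to W^*$. $\mathfrak p$-adic $L$-function: $L_{\mathfrak p}(X,y,\omega_{\mathfrak p}^i)=\sum_{n\ge0}\Big(\sum_{a\in A_{+,n}-\mathfrak p}\omega_{\mathfrak p}^i(a)\langle a\rangle_{\mathfrak p}^y\Big)X^n\in A_{\mathfrak p}[[X]]$. Stickelberger series: $\Lambda=W[[\Gamma]]$. $\Theta_\infty(X)=\prod_{\mathfrak q\notin S}(1-\mathrm{Fr}_{\mathfrak q}^{-1}X^{\deg\mathfrak q})^{-1}\in\mathbb Z[G_\infty][[X]]$ (product over places $\mathfrak q\notin S$ of $F$, $\mathrm{Fr}_{\mathfrak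 q}\in G_\infty$ arithmetic Frobenius), and for $\chi:\Delta\to W^*$, $\Theta_\infty(X,\chi)\in\Lambda[[X]]$ is its image under $\delta\sigma\mapsto\chi(\delta)\sigma$ ($\delta\in\Delta,\sigma\in\Gamma$). Sinnott map: $Dir(\mathbb Z_p,A_{\mathfrak p})$ is the closure, in the space $C^0(\mathbb Z_p,A_{\mathfrak p})$ of continuous functions with the uniform topology, of the $A_{\mathfrak p}$-module generated by the functions $\vartheta_u:y\mapsto u^y$, $u\in U_1$. The injective map $s:\Lambda/p\Lambda=\mathbb F_{\mathfrak p}[[\Gamma]]\to Dir(\mathbb Z_p,A_{\mathfrak p})$ is the continuous $\mathbb F_{\mathfrak p}$-algebra homomorphism with $s(\sigma)=\vartheta_{\kappa(\sigma)}$ for $\sigma\in\Gamma$; equivalently $s(\lambda)(y)=\int_\Gamma\kappa(\sigma)^y\,d\mu_\lambda(\sigma)$, where $\mu_\lambda$ is the measure attached to $\lambda$. The map $s_X:\Lambda[[X]]\to Dir(\mathbb Z_p,A_{\mathfrak p})[[X]]$ sends $\sum_nc_nX^n$ to the function $y\mapsto\sum_ns(\bar c_n)(y)X^n$, with $\bar c_n=c_n\bmod p$. *)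

(* Defs.v *)
From HB Require Import structures.
From mathcomp Require Import all_boot all_order all_algebra all_field.
From mathcomp Require Import boolp classical_sets functions cardinality fsbigop.
From mathcomp Require Import finmap monalg ring.

Set Implicit Arguments.
Unset Strict Implicit.
Unset Printing Implicit Defensive.

Import GRing.Theory.
Local Open Scope classical_set_scope.
Local Open Scope ring_scope.

Definition rdvd (R : nzRingType) (a b : R) : Prop := exists c, b = c * a.

Section ClassicalUnits.
Variable R : nzRingType.

Definition cl_unit : pred R := fun x => `[< exists y, y * x = 1 /\ x * y = 1 >].
Definition cl_inv (x : R) : R := xget x [set y | y * x = 1 /\ x * y = 1].

Lemma cl_mulVx : {in cl_unit, left_inverse 1 cl_inv *%R}.
Proof.
move=> x /asboolP [y yx]; rewrite /cl_inv.
by case: xgetP => [z _ [] //|/(_ y)].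
Qed.

Lemma cl_mulxV : {in cl_unit, right_inverse 1 cl_inv *%R}.
Proof.
move=> x /asboolP [y yx]; rewrite /cl_inv.
by case: xgetP => [z _ [] //|/(_ y)].
Qed.

Lemma cl_unitP x y : y * x = 1 /\ x * y = 1 -> cl_unit x.
Proof. by move=> yx; apply/asboolP; exists y. Qed.

Lemma cl_inv_out : {in [predC cl_unit], cl_inv =1 id}.
Proof.
move=> x /asboolP nx; rewrite /cl_inv; case: xgetP => // z _ zx.
by case: nx; exists z.
Qed.

End ClassicalUnits.

Section AdicCompletion.
Variables (R : comNzRingType) (x : R).

Definition adic_cauchy : {pred nat -> R} :=
  fun u => `[< forall n, rdvd (x ^+ n) (u n.+1 - u n) >].

Fact adic_cauchy_subring : subring_closed adic_cauchy.
Proof.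
split=> [|u v /asboolP hu /asboolP hv|u v /asboolP hu /asboolP hv];
  apply/asboolP => n.
- by exists 0; rewrite subrr mul0r.
- have [[a ha] [b hb]] := (hu n, hv n); exists (a - b).
  by rewrite mulrBl -ha -hb -[LHS]/(u n.+1 - v n.+1 - (u n - v n)); ring.
- have [[a ha] [b hb]] := (hu n, hv n); exists (a * v n.+1 + u n * b).
  by rewrite mulrDl mulrAC -ha -mulrA -hb mulrBl mulrBr addrA subrK.
Qed.
HB.instance Definition _ :=
  GRing.isSubringClosed.Build (nat -> R) adic_cauchy adic_cauchy_subring.

Record adic_seq := AdicSeq {
  adic_val :> nat -> R; _ : adic_val \in adic_cauchy }.
HB.instance Definition _ := [isSub for adic_val].
HB.instance Definition _ := [Choice of adic_seq by <:].
HB.instance Definition _ := [SubChoice_isSubComNzRing of adic_seq by <:].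

(* The quotient is a ring only if [x] is not a unit, hence the parameter. *)
Definition adic_null (hx : ~ rdvd x 1) : {pred adic_seq} :=
  fun u => `[< forall n, rdvd (x ^+ n) (u n) >].

Variable hx : ~ rdvd x 1.

Fact adic_null_ideal : idealr_closed (adic_null hx).
Proof.
split=> [||a u v /asboolP hu /asboolP hv].
- by apply/asboolP => n; exists 0; rewrite mul0r.
- by apply/negP => /asboolP /(_ 1); rewrite expr1; apply: hx.
- apply/asboolP => n; have [[b hb] [c hc]] := (hu n, hv n).
  exists (a n * b + c); rewrite mulrDl -mulrA -hb -hc.
  by [].
Qed.
HB.instance Definition _ :=
  isIdealr.Build adic_seq (adic_null hx) adic_null_ideal.

(* The completion of [R] for the topology defined by the ideal [(x)]. *)
Definition completion := {ideal_quot (adic_null hx)}.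
HB.instance Definition _ := GRing.ComNzRing.on completion.
HB.instance Definition _ := GRing.NzRing_hasMulInverse.Build completion
  (@cl_mulVx completion) (@cl_mulxV completion)
  (@cl_unitP completion) (@cl_inv_out completion).

Fact adic_const_cauchy (a : R) : (fun=> a) \in adic_cauchy.
Proof. by apply/asboolP => n; exists 0; rewrite subrr mul0r. Qed.

Definition to_completion (a : R) : completion :=
  (\pi_completion (AdicSeq (adic_const_cauchy a)))%qT.

Fact to_completion_is_zmod_morphism : zmod_morphism to_completion.
Proof.
by move=> a b; rewrite /to_completion -rmorphB; congr (\pi_completion%qT _); exact: val_inj.
Qed.
Fact to_completion_is_monoid_morphism : monoid_morphism to_completion.
Proof.
rewrite /to_completion; split=> [|a b].
  by rewrite -(rmorph1 \pi_completion%qT); congr (\pi_completion%qT _); exact: val_inj.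
by rewrite -rmorphM; congr (\pi_completion%qT _); exact: val_inj.
Qed.
HB.instance Definition _ := GRing.isZmodMorphism.Build R completion
  to_completion to_completion_is_zmod_morphism.
HB.instance Definition _ := GRing.isMonoidMorphism.Build R completion
  to_completion to_completion_is_monoid_morphism.

Definition adic_close (n : nat) (z t : completion) : Prop :=
  rdvd (to_completion x ^+ n) (z - t).

Definition adic_residue (z : completion) : R :=
  xget 0 [set a | adic_close 1 z (to_completion a)].

Definition adic_lim (u : nat -> completion) : completion :=
  xget 0 [set l | forall N, exists M, forall n, (M <= n)%N ->
    adic_close N (u n) l].

End AdicCompletion.

Record pseries (R : Type) := PSeries { pcoef :> nat -> R }.
HB.instance Definition _ (R : Type) := [isNew for @pcoef R].
HB.instance Definition _ (R : choiceType) := [Choice of pseries R by <:].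

Section PowerSeries.
Variable R : nzRingType.
Local Notation pseries := (pseries R).

Implicit Types f g h : pseries.

Lemma pseriesP f g : (forall n, f n = g n) -> f = g.
Proof. by move=> fg; apply: val_inj; apply/funext. Qed.

Definition ps_zero : pseries := PSeries (fun=> 0).
Definition ps_opp f : pseries := PSeries (fun n => - f n).
Definition ps_add f g : pseries := PSeries (fun n => f n + g n).
Definition ps_monom (c : R) (d : nat) : pseries := PSeries (fun n => c *+ (n == d)).
Definition ps_one := ps_monom 1 0.
Definition ps_mul f g : pseries := PSeries (fun n => \sum_(i < n.+1) f i * g (n - i)%N).

Fact ps_addA : associative ps_add.
Proof. by move=> f g h; apply: pseriesP => n /=; rewrite addrA. Qed.
Fact ps_addC : commutative ps_add.
Proof. by move=> f g; apply: pseriesP => n /=; rewrite addrC. Qed.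
Fact ps_add0 : left_id ps_zero ps_add.
Proof. by move=> f; apply: pseriesP => n /=; rewrite add0r. Qed.
Fact ps_addN : left_inverse ps_zero ps_opp ps_add.
Proof. by move=> f; apply: pseriesP => n /=; rewrite addNr. Qed.
HB.instance Definition _ :=
  GRing.isZmodule.Build pseries ps_addA ps_addC ps_add0 ps_addN.

Let trunc n f : {poly R} := \poly_(i < n.+1) f i.

Let ps_mul_trunc f g m n : (m <= n)%N ->
  ps_mul f g m = (trunc n f * trunc n g)`_m.
Proof.
move=> le_mn; rewrite coefM; apply: eq_bigr => i _; rewrite !coef_poly.
by rewrite !ltnS !(leq_trans _ le_mn) ?leq_subr // -ltnS.
Qed.

Fact ps_mulA : associative ps_mul.
Proof.
move=> f g h; apply: pseriesP => n.
transitivity ((trunc n f * (trunc n g * trunc n h))`_n).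
  rewrite coefM; apply: eq_bigr => i _.
  by rewrite (ps_mul_trunc g h (leq_subr i n)) coef_poly ltn_ord.
rewrite mulrA coefM; apply: eq_bigr => i _.
rewrite (@ps_mul_trunc f g i n) -1?ltnS // [(trunc n h)`__]coef_poly.
by rewrite ltnS leq_subr.
Qed.
Fact ps_mul1 : left_id ps_one ps_mul.
Proof.
move=> f; apply: pseriesP => n /=; rewrite big_ord_recl /= subn0 mul1r.
by rewrite big1 ?addr0 // => i _; rewrite mul0r.
Qed.
Fact ps_mulr1 : right_id ps_one ps_mul.
Proof.
move=> f; apply: pseriesP => n /=; rewrite big_ord_recr /= subnn mulr1.
rewrite big1 ?add0r // => i _.
by rewrite subn_eq0 leqNgt ltn_ord mulr0.
Qed.
Fact ps_mulDl : left_distributive ps_mul ps_add.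
Proof.
move=> f g h; apply: pseriesP => n /=; rewrite -big_split /=.
by apply: eq_bigr => i _; rewrite mulrDl.
Qed.
Fact ps_mulDr : right_distributive ps_mul ps_add.
Proof.
move=> f g h; apply: pseriesP => n /=; rewrite -big_split /=.
by apply: eq_bigr => i _; rewrite mulrDr.
Qed.
Fact ps_one_neq0 : ps_one != ps_zero.
Proof.
by apply/eqP => /(congr1 (fun f : pseries => f 0)) /eqP; rewrite /= oner_eq0.
Qed.
HB.instance Definition _ := GRing.Zmodule_isNzRing.Build pseries
  ps_mulA ps_mul1 ps_mulr1 ps_mulDl ps_mulDr ps_one_neq0.
HB.instance Definition _ := GRing.NzRing_hasMulInverse.Build pseries
  (@cl_mulVx pseries) (@cl_mulxV pseries)
  (@cl_unitP pseries) (@cl_inv_out pseries).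

(* The infinite product of the [f i], [i] in [D], for the X-adic topology: each
   coefficient is eventually constant along the finite subsets of [D], whatever
   the order of the factors. *)
Definition ps_prod (I : eqType) (D : set I) (f : I -> pseries) : pseries :=
  xget 0 [set F : pseries | forall n, exists s0 : seq I,
    {in s0, forall i, D i} /\
    forall s, uniq s -> {in s, forall i, D i} -> {subset s0 <= s} ->
      (\prod_(i <- s) f i) n = F n].

End PowerSeries.

Section GroupRing.
Variables (G : groupType) (R : nzRingType).

Definition group_ring := {malg R[G]}.
HB.instance Definition _ := GRing.Zmodule.on group_ring.

Implicit Types f g : {malg R[G]}.

Definition gr_one : {malg R[G]} := << 1%g >>.
Definition gr_mul f g : {malg R[G]} :=
  \sum_(a <- msupp f) \sum_(b <- msupp g) << f@_a * g@_b *g (a * b)%g >>.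

Let gr_mulE (d1 d2 : {fset G}) f g :
  (msupp f `<=` d1)%fset -> (msupp g `<=` d2)%fset ->
  gr_mul f g = \sum_(a <- d1) \sum_(b <- d2) << f@_a * g@_b *g (a * b)%g >>.
Proof.
move=> le_d1 le_d2; rewrite /gr_mul (big_fset_incl _ le_d1) /=.
  apply/eq_bigr=> a _; apply/big_fset_incl => // b _ /mcoeff_outdom ->.
  by rewrite mulr0 monalgU0.
move=> a _ /mcoeff_outdom fa.
by rewrite big1 // => b _; rewrite fa mul0r monalgU0.
Qed.

Let gr_mul0 : left_zero 0 gr_mul.
Proof. by move=> g; rewrite /gr_mul msupp0 big_seq_fset0. Qed.

Let gr_mulr0 : right_zero 0 gr_mul.
Proof.
by move=> g; rewrite /gr_mul msupp0 big1 // => a _; rewrite big_seq_fset0.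
Qed.

Let gr_mulUg c a g :
  gr_mul << c *g a >> g = \sum_(b <- msupp g) << c * g@_b *g (a * b)%g >>.
Proof.
rewrite (gr_mulE msuppU_le (fsubset_refl _)) big_seq_fset1.
by apply/eq_bigr => b _; rewrite mcoeffUU.
Qed.

Let gr_mulgU c b g :
  gr_mul g << c *g b >> = \sum_(a <- msupp g) << g@_a * c *g (a * b)%g >>.
Proof.
rewrite (gr_mulE (fsubset_refl _) msuppU_le).
by apply/eq_bigr => a _; rewrite big_seq_fset1 mcoeffUU.
Qed.

Let gr_mulUU c1 c2 a b :
  gr_mul << c1 *g a >> << c2 *g b >> = << c1 * c2 *g (a * b)%g >>.
Proof. by rewrite (gr_mulE msuppU_le msuppU_le) !big_seq_fset1 !mcoeffUU. Qed.

Fact gr_mul1 : left_id gr_one gr_mul.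
Proof.
move=> g; rewrite gr_mulUg [RHS]monalgE.
by apply/eq_bigr=> b _; rewrite mul1r mul1g.
Qed.

Fact gr_mulr1 : right_id gr_one gr_mul.
Proof.
move=> g; rewrite gr_mulgU [RHS]monalgE.
by apply/eq_bigr=> a _; rewrite mulr1 mulg1.
Qed.

Fact gr_mulDl : left_distributive gr_mul +%R.
Proof.
move=> f1 f2 g.
rewrite (gr_mulE (msuppD_le _ _) (fsubset_refl _)).
rewrite (gr_mulE (fsubsetUl _ (msupp f2)) (fsubset_refl _)).
rewrite (gr_mulE (fsubsetUr (msupp f1) _) (fsubset_refl _)).
rewrite -big_split /=; apply/eq_bigr=> a _.
rewrite -big_split /=; apply/eq_bigr=> b _.
by rewrite mcoeffD mulrDl monalgUD.
Qed.

Fact gr_mulDr : right_distributive gr_mul +%R.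
Proof.
move=> f g1 g2.
rewrite (gr_mulE (fsubset_refl _) (msuppD_le _ _)).
rewrite (gr_mulE (fsubset_refl _) (fsubsetUl _ (msupp g2))).
rewrite (gr_mulE (fsubset_refl _) (fsubsetUr (msupp g1) _)).
rewrite -big_split /=; apply/eq_bigr=> a _.
rewrite -big_split /=; apply/eq_bigr=> b _.
by rewrite mcoeffD mulrDr monalgUD.
Qed.

Fact gr_mulA : associative gr_mul.
Proof.
have mulEl f g : gr_mul f g = \sum_(a <- msupp f) gr_mul << f@_a *g a >> g.
  by apply/eq_bigr => a _; rewrite gr_mulUg.
have mulEr f g : gr_mul f g = \sum_(b <- msupp g) gr_mul f << g@_b *g b >>.
  by rewrite [LHS]/gr_mul exchange_big; apply/eq_bigr => b _; rewrite gr_mulgU.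
move=> f g h.
rewrite [RHS](big_morph (gr_mul^~ _) (fun _ _ => gr_mulDl _ _ _) (gr_mul0 _)).
rewrite mulEl; apply/eq_bigr=> a _.
rewrite [LHS](big_morph (gr_mul _) (fun _ _ => gr_mulDr _ _ _) (gr_mulr0 _)).
rewrite [RHS](big_morph (gr_mul^~ _) (fun _ _ => gr_mulDl _ _ _) (gr_mul0 _)).
apply/eq_bigr=> b _.
rewrite [LHS](big_morph (gr_mul _) (fun _ _ => gr_mulDr _ _ _) (gr_mulr0 _)).
by rewrite mulEr; apply/eq_bigr=> c _; rewrite !gr_mulUU mulrA mulgA.
Qed.

Fact gr_one_neq0 : gr_one != 0.
Proof. by apply/eqP/malgP=> /(_ 1%g) /eqP; rewrite !mcoeffsE oner_eq0. Qed.

HB.instance Definition _ := GRing.Zmodule_isNzRing.Build group_ring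
  gr_mulA gr_mul1 gr_mulr1 gr_mulDl gr_mulDr gr_one_neq0.

End GroupRing.

Section PadicIntegers.
Variables (p : nat) (p_pr : prime p).

Fact padic_proper : ~ rdvd p%:Z 1.
Proof.
case=> c /(congr1 absz); rewrite abszM => /esym /eqP.
by rewrite muln_eq1 => /andP[_ /eqP /= p1]; move: p_pr; rewrite p1.
Qed.

Definition padic_int := completion padic_proper.
HB.instance Definition _ := GRing.ComUnitRing.on padic_int.

Definition padic_binom (y : padic_int) (n : nat) : padic_int :=
  xget 0 [set b | n`!%:R * b = \prod_(j < n) (y - j%:R)].

End PadicIntegers.

(* The lift of [a] to a root of unity of [R], and 0 for [a = 0]; [red] is the
   reduction from [R] to its finite residue field. *)
Definition teich (kappa : finFieldType) (R : nzRingType) (red : R -> kappa)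
    (a : kappa) : R :=
  if a == 0 then 0 else xget 0 [set z | z ^+ #|kappa|.-1 = 1 /\ red z = a].

(* [R] with [red] is the Witt ring of the perfect field [kappa] of
   characteristic [p]: the strict p-ring with residue field [kappa], which these
   conditions determine up to a unique isomorphism. *)
Definition is_witt_ring (p : nat) (kappa : fieldType) (R : comNzRingType)
    (red : R -> kappa) : Prop :=
  [/\ forall a, exists w, red w = a,
      forall w, red w = 0 <-> rdvd p%:R w,
      forall w : R, p%:R * w = 0 -> w = 0,
      forall w : R, (forall n, rdvd (p%:R ^+ n) w) -> w = 0
    & forall u : nat -> R, (forall n, rdvd (p%:R ^+ n) (u n.+1 - u n)) ->
      exists l, forall n, rdvd (p%:R ^+ n) (l - u n)].

Section LocalRing.
Variables (k : finFieldType) (P : {poly k}) (hP : monic_irreducible_poly P).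

Fact prime_proper : ~ rdvd P 1.
Proof.
case=> c Pc; have [sP _] := hP.1.
have: size (c * P) = 1%N by rewrite -Pc size_poly1.
have P0 : P != 0 by rewrite -size_poly_gt0 (ltn_trans _ sP).
have c0 : c != 0 by apply/eqP => c0; move/eqP: Pc; rewrite c0 mul0r oner_eq0.
rewrite size_mul //; move: sP c0; rewrite -size_poly_gt0.
by case: (size P) => [|[|m]] //; case: (size c) => [|n] // _ _; rewrite !addnS addSn.
Qed.

Definition Ap := completion prime_proper.
HB.instance Definition _ := GRing.ComUnitRing.on Ap.

Definition to_Ap (a : {poly k}) : Ap := to_completion prime_proper a.

Definition red_Ap (z : Ap) : {poly %/ P with hP} :=
  in_qpoly P (adic_residue z).

Definition lift_Ap (a : {poly %/ P with hP}) : Ap := teich red_Ap a.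

Definition omega (a : {poly k}) : Ap := lift_Ap (in_qpoly P a).

Definition diamond (a : {poly k}) : Ap := to_Ap a / omega a.

(* [u ^ y] for a one-unit [u]. The coefficient [padic_binom y n] acts on [Ap],
   which has characteristic [p], through its residue class mod [p]. *)
Definition Ap_pow (p : nat) (p_pr : prime p) (u : Ap) (y : padic_int p_pr) :
    Ap :=
  adic_lim (fun N => \sum_(n < N)
    (adic_residue (padic_binom y n))%:~R * (u - 1) ^+ n).

Definition Lp (p : nat) (p_pr : prime p) (y : padic_int p_pr) (i : nat) :
    pseries Ap :=
  PSeries (fun n =>
    \sum_(a : {poly_(n.+1) k} |
            [&& val a \is monic, size (val a) == n.+1 & ~~ (P %| val a)])
      omega (val a) ^+ i * Ap_pow (diamond (val a)) y).

End LocalRing.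

Section Carlitz.
Variable k : finFieldType.

(* The twisted polynomial [\sum_j c_j tau ^ j] over [k(theta)] is encoded as the
   additive polynomial [\sum_j c_j X ^ (q ^ j)], the product of twisted
   polynomials becoming composition. *)
Definition carlitz_theta : {poly {fraction {poly k}}} :=
  tofrac 'X *: 'X + 'X ^+ #|k|.

Definition carlitz (a : {poly k}) : {poly {fraction {poly k}}} :=
  \sum_(j < size a)
    tofrac (a`_j)%:P *: iter j (fun f => carlitz_theta \Po f) 'X.

End Carlitz.

Definition gen_subfield (K : fieldType) (S : set K) : {pred K} :=
  fun x => `[< forall E : {pred K}, divring_closed E ->
    (forall y, S y -> y \in E) -> x \in E >].

Section GenSubfield.
Variable K : fieldType.

Lemma gen_subfield_closed (S : set K) : divring_closed (gen_subfield S).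
Proof.
split=> [|x y /asboolP hx /asboolP hy|x y /asboolP hx /asboolP hy];
  apply/asboolP => E hE SE; have [h1 hB hV] := hE; first exact: h1.
- by apply: hB; [apply: hx|apply: hy].
- by apply: hV; [apply: hx|apply: hy].
Qed.

Lemma gen_subfield_sub (S T : set K) : S `<=` T ->
  {subset gen_subfield S <= gen_subfield T}.
Proof.
by move=> ST x /asboolP hx; apply/asboolP => E hE TE; apply: hx => // y /ST /TE.
Qed.

Lemma mem_gen_subfield (S : set K) x : S x -> x \in gen_subfield S.
Proof. by move=> Sx; apply/asboolP => E _; apply. Qed.

End GenSubfield.

Section CyclotomicTower.
Variables (k : finFieldType) (P : {poly k}).
Variables (Omega : closedFieldType).
Variable iota : {rmorphism {fraction {poly k}} -> Omega}.

Definition torsion (a : {poly k}) : set Omega :=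
  [set x | root (map_poly iota (carlitz a)) x].

(* The field [k(theta)(Phi[P ^ n.+1])], inside an algebraically closed extension
   [Omega] of [k(theta)]. *)
Definition Fn (n : nat) : {pred Omega} :=
  gen_subfield (range iota `|` torsion (P ^+ n.+1)).

Definition Finf_pred : {pred Omega} := fun x => `[< exists n, x \in Fn n >].

Definition carlitz_step (x : Omega) : Omega :=
  iota (tofrac 'X) * x + x ^+ #|k|.

Definition carlitz_eval (a : {poly k}) (x : Omega) : Omega :=
  (map_poly iota (carlitz a)).[x].

Lemma carlitz_evalE (a : {poly k}) x N : (size a <= N)%N ->
  carlitz_eval a x =
  \sum_(j < N) iota (tofrac (a`_j)%:P) * iter j carlitz_step x.
Proof.
move=> aN; rewrite /carlitz_eval /carlitz rmorph_sum horner_sum.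
transitivity (\sum_(j < size a)
    iota (tofrac (a`_j)%:P) * iter j carlitz_step x).
  apply: eq_bigr => j _; rewrite /= map_polyZ hornerZ; congr (_ * _).
  elim: (nat_of_ord j) => [|m IH] /=; first by rewrite map_polyX hornerX.
  rewrite map_comp_poly horner_comp IH /carlitz_theta rmorphD /= map_polyZ.
  by rewrite map_polyX rmorphXn /= map_polyX hornerD hornerZ hornerX hornerXn.
rewrite (big_ord_widen N (fun j =>
  iota (tofrac (a`_j)%:P) * iter j carlitz_step x) aN) big_mkcond /=.
apply: eq_bigr => j _; case: ltnP => // aj.
by rewrite nth_default // polyC0 !rmorph0 mul0r.
Qed.

Lemma carlitz_evalD a b x :
  carlitz_eval (a + b) x = carlitz_eval a x + carlitz_eval b x.
Proof.
rewrite (carlitz_evalE x (size_polyD a b)).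
rewrite (carlitz_evalE x (leq_maxl _ (size b))).
rewrite (carlitz_evalE x (leq_maxr (size a) _)) -big_split /=.
by apply: eq_bigr => j _; rewrite coefD polyCD !rmorphD mulrDl.
Qed.

Lemma carlitz_evalZ c a x :
  carlitz_eval (c *: a) x = iota (tofrac c%:P) * carlitz_eval a x.
Proof.
rewrite (carlitz_evalE x (size_scale_leq c a)) (carlitz_evalE x (leqnn _)).
rewrite mulr_sumr.
by apply: eq_bigr => j _; rewrite coefZ polyCM !rmorphM mulrA.
Qed.

Lemma pnat_card_base : [pchar Omega].-nat #|k|.
Proof.
have [p p_pr p_char] := finPcharP k.
have pO : p \in [pchar Omega].
  have pA := rmorph_pchar (@polyC k) p_char.
  have pF := rmorph_pchar (@tofrac {poly k}) pA.
  exact: (rmorph_pchar iota pF).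
rewrite (card_pprimeChar p_char) pnatX; apply/orP; left.
by rewrite pnatE.
Qed.

Fact carlitz_step_is_zmod_morphism : zmod_morphism carlitz_step.
Proof.
move=> x y; rewrite /carlitz_step mulrBr (exprDn_pchar _ _ pnat_card_base).
by rewrite exprNn_pchar ?pnat_card_base // opprD addrACA.
Qed.
HB.instance Definition _ := GRing.isZmodMorphism.Build Omega Omega
  carlitz_step carlitz_step_is_zmod_morphism.

Lemma carlitz_stepZ (c : k) x :
  carlitz_step (iota (tofrac c%:P) * x) = iota (tofrac c%:P) * carlitz_step x.
Proof.
have cq : tofrac c%:P ^+ #|k| = tofrac c%:P.
  by rewrite -[LHS]rmorphXn -polyC_exp expf_card.
by rewrite /carlitz_step mulrCA [RHS]mulrDr exprMn -rmorphXn cq.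
Qed.

Lemma carlitz_evalMX a x :
  carlitz_eval (a * 'X) x = carlitz_step (carlitz_eval a x).
Proof.
have le_s : (size (a * 'X)%R <= (size a).+1)%N.
  by rewrite (leq_trans (size_polyMleq _ _)) // size_polyX addn2.
rewrite (carlitz_evalE x le_s) (carlitz_evalE x (leqnn _)) big_ord_recl /=.
rewrite coefMX eqxx polyC0 !rmorph0 mul0r add0r raddf_sum.
by apply: eq_bigr => j _; rewrite coefMX /= add0n carlitz_stepZ.
Qed.

Lemma torsionM a b : torsion a `<=` torsion (b * a).
Proof.
move=> x /rootP ax; apply/rootP; rewrite -/(carlitz_eval (b * a) x).
elim/poly_ind: b => [|b c IH].
  by rewrite mul0r (@carlitz_evalE _ _ 0) ?size_poly0 // big_ord0.
rewrite mulrDl mulrAC carlitz_evalD carlitz_evalMX IH raddf0 add0r.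
by rewrite mul_polyC carlitz_evalZ [carlitz_eval _ _]ax mulr0.
Qed.

Lemma Fn_S n : {subset Fn n <= Fn n.+1}.
Proof.
apply: gen_subfield_sub => x [ix|tx]; [by left|right].
by rewrite exprS; apply: torsionM.
Qed.

Lemma Fn_le m n : (m <= n)%N -> {subset Fn m <= Fn n}.
Proof.
move=> /subnK <-; elim: (n - m)%N => [|j IH] x // /IH; exact: Fn_S.
Qed.

Fact Finf_closed : divring_closed Finf_pred.
Proof.
have cl n := gen_subfield_closed (range iota `|` torsion (P ^+ n.+1)).
split=> [|x y /asboolP [m xm] /asboolP [n yn]
         |x y /asboolP [m xm] /asboolP [n yn]]; apply/asboolP.
- by exists 0; have [] := cl 0.
- exists (maxn m n); have [_ hB _] := cl (maxn m n).
  by apply: hB; [apply: Fn_le xm; apply: leq_maxl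
                |apply: Fn_le yn; apply: leq_maxr].
- exists (maxn m n); have [_ _ hV] := cl (maxn m n).
  by apply: hV; [apply: Fn_le xm; apply: leq_maxl
                |apply: Fn_le yn; apply: leq_maxr].
Qed.
HB.instance Definition _ :=
  GRing.isDivringClosed.Build Omega Finf_pred Finf_closed.

Record Finf := MkFinf { Finf_val :> Omega; _ : Finf_val \in Finf_pred }.
HB.instance Definition _ := [isSub for Finf_val].
HB.instance Definition _ := [Choice of Finf by <:].
HB.instance Definition _ := [SubChoice_isSubIntegralDomain of Finf by <:].
HB.instance Definition _ := [SubIntegralDomain_isSubField of Finf by <:].

Fact base_in_Finf a : iota a \in Finf_pred.
Proof. by apply/asboolP; exists 0; apply: mem_gen_subfield; left; exists a. Qed.

Definition to_Finf (a : {fraction {poly k}}) : Finf := MkFinf (base_in_Finf a).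

(* [Ginf] is the group Gal(Finf / k(theta)). *)
Definition is_galois : pred (Finf -> Finf) := fun s =>
  `[< [/\ zmod_morphism s, monoid_morphism s, bijective s
        & forall a, s (to_Finf a) = to_Finf a ] >].

Record Ginf := MkGinf { Ginf_val :> Finf -> Finf; _ : is_galois Ginf_val }.
HB.instance Definition _ := [isSub for Ginf_val].
HB.instance Definition _ := [Choice of Ginf by <:].

Fact gal_is_zmod_morphism (s : Ginf) : zmod_morphism s.
Proof. by have /asboolP [] := valP s. Qed.
Fact gal_is_monoid_morphism (s : Ginf) : monoid_morphism s.
Proof. by have /asboolP [] := valP s. Qed.
HB.instance Definition _ (s : Ginf) := GRing.isZmodMorphism.Build Finf Finf
  (Ginf_val s) (gal_is_zmod_morphism s).
HB.instance Definition _ (s : Ginf) := GRing.isMonoidMorphism.Build Finf Finf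
  (Ginf_val s) (gal_is_monoid_morphism s).
Lemma gal_base (s : Ginf) a : s (to_Finf a) = to_Finf a.
Proof. by have /asboolP [] := valP s. Qed.

Fact gal_one_subproof : is_galois id.
Proof. by apply/asboolP; split=> //; exists id. Qed.
Definition gal_one := MkGinf gal_one_subproof.

Fact gal_mul_subproof (s t : Ginf) : is_galois (s \o t).
Proof.
case: s t => [s /asboolP [sB sM sb sF]] [t /asboolP [tB tM tb tF]] /=.
apply/asboolP; split=> [x y||| a] /=; first by rewrite tB sB.
- by split=> [|x y] /=; rewrite ?tM.1 ?sM.1 // tM.2 sM.2.
- exact: bij_comp.
- by rewrite tF sF.
Qed.
Definition gal_mul s t := MkGinf (gal_mul_subproof s t).

Definition gal_inv_fun (s : Ginf) : Finf -> Finf :=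
  @xget (Finf -> Finf) id [set t : Finf -> Finf | cancel s t /\ cancel t s].

Lemma gal_inv_funP (s : Ginf) : cancel s (gal_inv_fun s) /\ cancel (gal_inv_fun s) s.
Proof.
case: s => s hs; have /asboolP [_ _ [t st ts] _] := hs; rewrite /gal_inv_fun.
by case: xgetP => [u _ //|/(_ t)]; case.
Qed.

Fact gal_inv_subproof (s : Ginf) : is_galois (gal_inv_fun s).
Proof.
have [st ts] := gal_inv_funP s; move: (gal_inv_fun s) st ts => t st ts.
case: s st ts => [s /asboolP [sB sM sb sF]] /= st ts.
have s_inj := can_inj st.
apply/asboolP; split=> [x y|||a]; first by apply: s_inj; rewrite sB !ts.
- split=> [|x y]; apply: s_inj; first by rewrite ts sM.1.
  by rewrite sM.2 !ts.
- by exists s.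
- by apply: s_inj; rewrite ts sF.
Qed.
Definition gal_inv s := MkGinf (gal_inv_subproof s).

Fact gal_mulA : associative gal_mul.
Proof. by move=> s t u; apply: val_inj. Qed.
Fact gal_mul1 : left_id gal_one gal_mul.
Proof. by move=> s; apply: val_inj. Qed.
Fact gal_mulr1 : right_id gal_one gal_mul.
Proof. by move=> s; apply: val_inj. Qed.
Fact gal_mulV : left_inverse gal_one gal_inv gal_mul.
Proof.
by move=> s; apply: val_inj; apply/funext => x; apply: (gal_inv_funP s).1.
Qed.
Fact gal_mulrV : right_inverse gal_one gal_inv gal_mul.
Proof.
by move=> s; apply: val_inj; apply/funext => x; apply: (gal_inv_funP s).2.
Qed.
HB.instance Definition _ :=
  isGroup.Build Ginf gal_mulA gal_mul1 gal_mulr1 gal_mulV gal_mulrV.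

(* [Gam n] is Gal(Finf / Fn n); the group called Gamma is [Gam 0]. *)
Definition Gam (n : nat) : set Ginf :=
  [set s | forall x : Finf, val x \in Fn n -> s x = x].


(* The cosets of [Gam n] in [Gam 0]. *)
Definition is_coset (n : nat) (C : set Ginf) : Prop :=
  exists2 s, Gam 0 s & C = [set t | Gam n (s^-1 * t)%g].
Record coset (n : nat) := MkCoset {
  coset_val :> set Ginf; _ : `[< is_coset n coset_val >] }.
HB.instance Definition _ n := [isSub for @coset_val n].
HB.instance Definition _ n := [Choice of coset n by <:].

Definition coset_repr n (C : coset n) : Ginf := xget 1%g C.

(* [R[[Gamma]]] as the limit of the [R[Gamma / Gam n]]. As [Gamma / Gam n] is
   finite (lemma [finite_coset] below), an element of [R[Gamma / Gam n]] is a
   function on [coset n]. *)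
Record iwasawa (R : nmodType) := Iwasawa {
  iw_coef :> forall n, coset n -> R;
  _ : forall n (C : coset n),
    iw_coef C = \sum_(C' \in [set C' : coset n.+1 | C' `<=` C]) iw_coef C'
}.

Lemma GamP n : Gam n 1%g /\
  forall s t : Ginf, Gam n s -> Gam n t -> Gam n (s^-1 * t)%g.
Proof.
split=> [x //|s t hs ht x xn]; rewrite -[LHS]/(s^-1%g (t x)) ht //.
by rewrite -[in LHS](hs x xn); apply: (gal_inv_funP s).1.
Qed.

Lemma Gam_le m n : (m <= n)%N -> Gam n `<=` Gam m.
Proof. by move=> le_mn s hs x xm; apply: hs; apply: Fn_le xm. Qed.

Lemma GamV n s : Gam n s -> Gam n s^-1%g.
Proof. by move=> hs; rewrite -[s^-1%g]mulg1; apply: (GamP n).2 => //; case: (GamP n). Qed.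

Lemma GamM n s t : Gam n s -> Gam n t -> Gam n (s * t)%g.
Proof. by move=> hs ht; rewrite -[s]invgK; apply: (GamP n).2 => //; apply: GamV. Qed.

Lemma coset_reprP n (C : coset n) :
  Gam 0 (coset_repr C) /\ coset_val C = [set t | Gam n ((coset_repr C)^-1 * t)%g].
Proof.
case: C => C hC; rewrite /coset_repr /=; have /asboolP[s s0 Cs] := hC.
have Cs' : C s by rewrite Cs /= mulVg; case: (GamP n).
case: xgetP => [t _ Ct|/(_ s)//]; rewrite Cs /= in Ct.
split.
  have := GamM s0 (Gam_le (leq0n n) Ct).
  by rewrite mulgA mulgV mul1g.
rewrite Cs; apply/seteqP; split=> u /= hu.
  have -> : (t^-1 * u = (s^-1 * t)^-1 * (s^-1 * u))%g.
    by rewrite invgM invgK -mulgA [(s * _)%g]mulgA mulgV mul1g.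
  exact: (GamP n).2.
have -> : (s^-1 * u = (s^-1 * t) * (t^-1 * u))%g.
  by rewrite -mulgA [(t * _)%g]mulgA mulgV mul1g.
exact: GamM.
Qed.

Lemma mem_coset_repr n (C : coset n) : coset_val C (coset_repr C).
Proof. by rewrite (coset_reprP C).2 /= mulVg; case: (GamP n). Qed.

Lemma deriv_carlitz (a : {poly k}) : (carlitz a)^`() = (tofrac a)%:P.
Proof.
have q0 : (#|k|%:R : {fraction {poly k}}) = 0.
  have [p p_pr p_char] := finPcharP k.
  have pA := rmorph_pchar (@polyC k) p_char.
  have /andP[_ /eqP p0] := rmorph_pchar (@tofrac {poly k}) pA.
  have [m qm] : exists m, #|k| = (p ^ m)%N.
    by exists (logn p #|k|); exact: (card_pprimeChar p_char).
  by have := finNzRing_gt1 k; rewrite qm natrX p0 expr0n; case: m {qm}.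
have dth : (carlitz_theta k)^`() = (tofrac 'X)%:P.
  rewrite /carlitz_theta derivD derivZ derivX derivXn -mulr_natr -polyC_natr.
  by rewrite q0 mulr0 addr0 alg_polyC.
have dit j : (iter j (fun f => carlitz_theta k \Po f) 'X)^`() =
    (tofrac ('X ^+ j : {poly k}))%:P.
  elim: j => [|j IH].
    rewrite expr0 tofrac1 polyC1.
    exact: derivX.
  rewrite iterS deriv_comp IH dth comp_polyC exprS.
  rewrite tofracM polyCM.
  by [].
rewrite /carlitz raddf_sum -[in RHS](coefK a) poly_def.
rewrite [tofrac (\sum_(_ < _) _)]rmorph_sum [RHS]rmorph_sum.
apply: eq_bigr => j _; rewrite [LHS]derivZ dit -mul_polyC -polyCM.
by congr _%:P; rewrite -mul_polyC; apply/esym; exact: tofracM.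
Qed.

Lemma Gam_torsion n (s : Ginf) : (forall x : Finf, torsion (P ^+ n.+1) (val x) -> s x = x) ->
  Gam n s.
Proof.
move=> hs x xn.
pose E : {pred Omega} :=
  fun y => `[< exists z : Finf, val z = y /\ s z = z >].
have inj := @val_inj _ _ Finf.
have EP (z : Finf) : val z \in E -> s z = z.
  by move=> /asboolP [w [/inj <-]].
apply: EP; move/asboolP: xn; apply; last first.
  move=> y [[a _ <-]|ty].
    by apply/asboolP; exists (to_Finf a); split=> //; apply: gal_base.
  have yF : y \in Finf_pred.
    by apply/asboolP; exists n; apply: mem_gen_subfield; right.
  by apply/asboolP; exists (MkFinf yF); split=> //; apply: hs.
split.
- by apply/asboolP; exists 1; split=> //; apply: rmorph1.
- move=> _ _ /asboolP [u [<- su]] /asboolP [v [<- sv]]; apply/asboolP.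
  by exists (u - v); split; [exact: rmorphB|rewrite [LHS]rmorphB /= su sv].
- move=> _ _ /asboolP [u [<- su]] /asboolP [v [<- sv]]; apply/asboolP.
  by exists (u / v); split; [exact: fmorph_div|rewrite [LHS]fmorph_div /= su sv].
Qed.

Lemma torsionE (a : {poly k}) (x : Finf) : torsion a (val x) <->
  \sum_(j < size a) to_Finf (tofrac (a`_j)%:P) *
    iter j (fun y => to_Finf (tofrac 'X) * y + y ^+ #|k|) x = 0.
Proof.
pose f (y : Finf) := to_Finf (tofrac 'X) * y + y ^+ #|k|.
have fE j : val (iter j f x) = iter j carlitz_step (val x).
  elim: j => [|j IH]; first by [].
  by rewrite [in RHS]iterS -IH [in LHS]iterS rmorphD rmorphM rmorphXn.
apply: (iff_trans (B := carlitz_eval a (val x) = 0)); first by split=> /rootP.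
rewrite (carlitz_evalE _ (leqnn _)).
have -> : \sum_(j < size a) iota (tofrac (a`_j)%:P) *
    iter j carlitz_step (val x) =
  val (\sum_(j < size a) to_Finf (tofrac (a`_j)%:P) * iter j f x).
  rewrite rmorph_sum; apply: eq_bigr => j _.
  by rewrite [RHS]rmorphM; congr (_ * _); rewrite -fE.
split=> [e|->]; last by rewrite rmorph0.
by apply: val_inj; rewrite e rmorph0.
Qed.

Lemma torsion_gal a (s : Ginf) (x : Finf) :
  torsion a (val x) -> torsion a (val (s x)).
Proof.
pose f (y : Finf) := to_Finf (tofrac 'X) * y + y ^+ #|k|.
have sf j : s (iter j f x) = iter j f (s x).
  elim: j => [|j IH] //=.
  by rewrite rmorphD rmorphM rmorphXn /= IH gal_base.
rewrite !torsionE => /(congr1 s); rewrite [s 0]rmorph0 rmorph_sum => s0; rewrite -[RHS]s0.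
by apply: eq_bigr => j _; rewrite [RHS]rmorphM [in RHS]/= gal_base sf.
Qed.

Lemma torsion_finite n : P != 0 ->
  exists r : seq Omega, forall x, torsion (P ^+ n) x -> x \in r.
Proof.
move=> P0; set f := map_poly iota (carlitz (P ^+ n)).
have f0 : f != 0.
  rewrite map_poly_eq0; apply/eqP => c0; have := deriv_carlitz (P ^+ n).
  by rewrite c0 deriv0 => /esym/eqP; rewrite polyC_eq0 tofrac_eq0 expf_eq0 (negPf P0) andbF.
have [r fr] := closed_field_poly_normal f; exists r => x.
rewrite /torsion /= -/f fr rootZ ?lead_coef_eq0 //.
by rewrite root_prod_XsubC.
Qed.

Lemma finite_coset n : P != 0 -> finite_set [set: coset n].
Proof.
move=> P0; have [r rP] := torsion_finite n.+1 P0.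
pose g (C : coset n) : {ffun 'I_(size r) * 'I_(size r) -> bool} :=
  [ffun ij : 'I_(size r) * 'I_(size r) => `[< exists x : Finf, val x = nth 0 r ij.1 /\
    val (coset_repr C x) = nth 0 r ij.2 >]].
have g_inj : injective g.
  move=> C D CD; apply: val_inj; rewrite /= (coset_reprP C).2.
  have CD1 : Gam n ((coset_repr C)^-1 * coset_repr D)%g.
    apply: Gam_torsion => x tx.
    have [xr sxr] := (rP _ tx, rP _ (torsion_gal (coset_repr C) tx)).
    have xi : (index (val x) r < size r)%N by rewrite index_mem.
    have sxi : (index (val (coset_repr C x)) r < size r)%N by rewrite index_mem.
    have gC : g C (Ordinal xi, Ordinal sxi).
      by rewrite ffunE /=; apply/asboolP; exists x; rewrite !nth_index.
    move: gC; rewrite CD ffunE /= !nth_index // => /asboolP.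
    case=> y [/val_inj -> /val_inj xy].
    rewrite -[LHS]/((coset_repr C)^-1%g (coset_repr D x)) xy.
    exact: (gal_inv_funP _).1.
  rewrite (coset_reprP D).2; apply/seteqP; split=> u /= hu.
    have -> : ((coset_repr D)^-1 * u =
        ((coset_repr C)^-1 * coset_repr D)^-1 * ((coset_repr C)^-1 * u))%g.
      by rewrite invgM invgK -mulgA [(coset_repr C * _)%g]mulgA mulgV mul1g.
    exact: (GamP n).2.
  have -> : ((coset_repr C)^-1 * u =
      ((coset_repr C)^-1 * coset_repr D) * ((coset_repr D)^-1 * u))%g.
    by rewrite -mulgA [(coset_repr D * _)%g]mulgA mulgV mul1g.
  exact: GamM.
have /finite_preimage : finite_set [set: {ffun 'I_(size r) * 'I_(size r) -> bool}].
  exact: finite_finset.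
by move=> /(_ _ g); apply=> C D _ _; apply: g_inj.
Qed.

End CyclotomicTower.

Arguments iw_coef {k P Omega iota R} _ _ _.

Section Stickelberger.
Variables (k : finFieldType) (P : {poly k}) (hP : monic_irreducible_poly P).
Variables (Omega : closedFieldType).
Variable iota : {rmorphism {fraction {poly k}} -> Omega}.

Local Notation Ginf := (Ginf P iota).
Local Notation Finf := (Finf P iota).
Local Notation Gam := (@Gam k P Omega iota).
Local Notation coset := (@coset k P Omega iota).
Local Notation iwasawa := (iwasawa P iota).
Local Notation Ap := (Ap hP).
Local Notation Fp := {poly %/ P with hP}.

Let P0 : P != 0.
Proof. exact: monic_neq0 hP.2. Qed.

Let fin_coset n (A : set (coset n)) : finite_set A.
Proof. exact: sub_finite_set (@subsetT _ A) (finite_coset iota n P0). Qed.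

Fact iw_map_subproof (R S : nmodType) (f : {additive R -> S})
    (l : iwasawa R) n (C : coset n) :
  f (iw_coef l n C) =
    \sum_(C' \in [set C' : coset n.+1 | C' `<=` C]) f (iw_coef l n.+1 C').
Proof.
by case: l => l /= ->; rewrite !fsbig_finite ?raddf_sum //; apply: fin_coset.
Qed.
Definition iw_map (R S : nmodType) (f : {additive R -> S}) (l : iwasawa R) :
    iwasawa S :=
  Iwasawa (iw_map_subproof f l).

Fact iw_dirac_subproof (R : nmodType) (s : seq Ginf) (c : Ginf -> R)
    (g : Ginf -> Ginf) n (C : coset n) :
  \sum_(x <- s) c x *+ `[< coset_val C (g x) >] =
  \sum_(C' \in [set C' : coset n.+1 | C' `<=` C])
    \sum_(x <- s) c x *+ `[< coset_val C' (g x) >].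
Proof.
rewrite fsbig_finite; last exact: fin_coset.
rewrite exchange_big; apply: eq_bigr => x _ /=.
rewrite -(@fsbig_finite _ _ _ _ [set C' : coset n.+1 | C' `<=` C]
  (fun C' => c x *+ `[< coset_val C' (g x) >])); last exact: fin_coset.
case: asboolP => [Cx|Cx]; last first.
  rewrite fsbig1 // => C' /= CC'; case: asboolP => // /CC' //.
have [r0 Cr] := coset_reprP C.
have g0 : Gam 0 (g x).
  have := Cx; rewrite Cr /= => /(Gam_le (leq0n n)) /(GamM r0).
  by rewrite mulgA mulgV mul1g.
have hD : `[< is_coset n.+1 [set t | Gam n.+1 ((g x)^-1 * t)%g] >].
  by apply/asboolP; exists (g x).
pose D := MkCoset hD.
have DC : D `<=` C.
  move=> t /= /(Gam_le (leqnSn n)) ht; rewrite Cr /=.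
  have -> : ((coset_repr C)^-1 * t =
      ((coset_repr C)^-1 * g x) * ((g x)^-1 * t))%g.
    by rewrite -mulgA [(g x * _)%g]mulgA mulgV mul1g.
  by apply: GamM => //; move: Cx; rewrite {1}Cr.
have Dx : coset_val D (g x) by rewrite /= mulVg; case: (GamP P iota n.+1).
rewrite -(@fsbig_widen _ _ _ _ [set D]) ?fsbig_set1.
- by case: asboolP.
- by move=> _ ->.
- move=> C' /= [_ C'D]; case: asboolP => // C'x; case: C'D.
  apply: val_inj => /=; have [_ C'r] := coset_reprP C'.
  have C'x' := C'x; rewrite C'r /= in C'x'.
  rewrite C'r; apply/seteqP; split=> t /= ht.
    have -> : ((g x)^-1 * t = ((coset_repr C')^-1 * g x)^-1 *
        ((coset_repr C')^-1 * t))%g.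
      by rewrite invgM invgK -mulgA [(coset_repr C' * _)%g]mulgA mulgV mul1g.
    exact: (GamP P iota n.+1).2.
  have -> : ((coset_repr C')^-1 * t =
      ((coset_repr C')^-1 * g x) * ((g x)^-1 * t))%g.
    by rewrite -mulgA [(g x * _)%g]mulgA mulgV mul1g.
  exact: GamM.
Qed.

(* The finite sum of the [c x [g x]], [x] in [s], an element of [R[Gamma]] when
   [g] takes its values in [Gamma]. *)
Definition iw_dirac (R : nmodType) (s : seq Ginf) (c : Ginf -> R)
    (g : Ginf -> Ginf) : iwasawa R :=
  Iwasawa (iw_dirac_subproof s c g).

(* An element [z] of [Ap] acts on the [P ^ n]-torsion, through the formal
   Drinfeld module extending the Carlitz module, as any [a] congruent to [z]
   mod [P ^ n]. *)
Definition is_cyclotomic_char (kappa : Ginf -> Ap) : Prop :=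
  [/\ {morph kappa : s t / (s * t)%g >-> s * t},
      injective kappa,
      forall u, u \is a GRing.unit <-> exists s, kappa s = u
    & forall (s : Ginf) n a (eps : Finf),
        adic_close n (kappa s) (to_Ap hP a) ->
        torsion iota (P ^+ n) (val eps) ->
        val (s eps) = carlitz_eval iota a (val eps)].

(* [D] is the subgroup Delta: cyclic of order [q ^ d - 1], with
   [Ginf = D x Gamma]. *)
Definition is_Delta (D : set Ginf) : Prop :=
  [/\ exists2 g : Ginf, D = [set (g ^+ j)%g | j in [set: nat]]
        & forall j, (g ^+ j)%g = 1%g <-> (#|k| ^ (size P).-1 - 1 %| j)%N,
      forall s t, D s -> Gam 0 t -> commute s t,
      D `&` Gam 0 = [set 1%g]
    & forall g : Ginf, exists s t, [/\ D s, Gam 0 t & g = (s * t)%g]].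

Definition Delta_part (D : set Ginf) (g : Ginf) : Ginf :=
  xget 1%g [set s | D s /\ Gam 0 (s^-1 * g)%g].
Definition Gamma_part (D : set Ginf) (g : Ginf) : Ginf :=
  ((Delta_part D g)^-1 * g)%g.

(* The places outside [S = {P, oo}], given by their monic generators. *)
Definition places : set {poly k} :=
  [set Q | [/\ Q \is monic, irreducible_poly Q & Q <> P]].

Definition A_to_Finf (a : {poly k}) : Finf := to_Finf P iota (tofrac a).

Definition is_prime_above (Q : {poly k}) (J : set Finf) : Prop :=
  let O := [set x : Finf | integralOver A_to_Finf x] in
  [/\ J `<=` O /\ ~ J 1,
      forall x y, J x -> J y -> J (x + y),
      forall x y, O x -> J y -> J (x * y),
      forall x y, O x -> O y -> J (x * y) -> J x \/ J y
    & forall a, J (A_to_Finf a) <-> Q %| a].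

(* As [Ginf] is abelian, the condition does not depend on the prime [J] of the
   integral closure of [k[theta]] in [Finf] above [Q]. *)
Definition is_frobenius (Q : {poly k}) (s : Ginf) : Prop :=
  exists2 J, is_prime_above Q J
    & forall x, integralOver A_to_Finf x -> J (s x - x ^+ (#|k| ^ (size Q).-1)).

Definition Theta (Fr : {poly k} -> Ginf) : pseries (group_ring Ginf int) :=
  ps_prod places (fun Q =>
    (1 - ps_monom (<< (Fr Q)^-1%g >> : group_ring Ginf int) (size Q).-1)^-1).

Section Character.
Variables (W : comUnitRingType) (redW : {rmorphism W -> Fp}).
Variables (kappa : Ginf -> Ap) (D : set Ginf).

(* For [s] in Delta, [kappa s] is the lift of its reduction mod [P]. *)
Definition omega_tilde (s : Ginf) : W := teich redW (red_Ap (kappa s)).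

Definition gr_twist (chi : Ginf -> W) (z : group_ring Ginf int) : iwasawa W :=
  iw_dirac (msupp z) (fun g => (mcoeff g z)%:~R * chi (Delta_part D g))
    (Gamma_part D).

Definition Theta_chi (Fr : {poly k} -> Ginf) (chi : Ginf -> W) :
    pseries (iwasawa W) :=
  PSeries (fun n => gr_twist chi (Theta Fr n)).

(* [\int_Gamma f dmu] for the measure [mu] on [Gamma] attached to [l], with
   values in [Fp], as a limit of Riemann sums. *)
Definition iw_integral (f : Ginf -> Ap) (l : iwasawa Fp) : Ap :=
  adic_lim (fun n => \sum_(C \in [set: coset n])
    lift_Ap (iw_coef l n C) * f (coset_repr C)).

Definition sinnott (p : nat) (p_pr : prime p) (l : iwasawa Fp)
    (y : padic_int p_pr) : Ap :=
  iw_integral (fun s => Ap_pow (kappa s) y) l.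

Definition sinnott_X (p : nat) (p_pr : prime p) (f : pseries (iwasawa W))
    (y : padic_int p_pr) : pseries Ap :=
  PSeries (fun n => sinnott (iw_map redW (f n)) y).

End Character.

End Stickelberger.

(* Main.v *)
Require Import Defs.
From HB Require Import structures.
From mathcomp Require Import all_boot all_order all_algebra all_field.
From mathcomp Require Import boolp classical_sets fsbigop cardinality.
From mathcomp Require Import finmap monalg ring.

Set Implicit Arguments.
Unset Strict Implicit.
Unset Printing Implicit Defensive.

Import GRing.Theory.
Local Open Scope classical_set_scope.
Local Open Scope ring_scope.

(** By uniqueness of factorization, the X^n-coefficient of the Euler product
    [Theta] is the sum over the monic [a] of degree [n] prime to [P] of the
    inverse Artin symbols [artin a], where [Fr Q] is the Artin symbol of [Q].
    The point is that [kappa (artin a) = a]: for a prime [Q] other than [P],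
    [Phi_Q(X)] is congruent to [X ^ (q ^ deg Q)] mod [Q], so [Phi_Q] and the
    Frobenius at [Q] agree on the [P]-power torsion modulo a prime above [Q],
    and reduction at such a prime is injective on this torsion.  The Sinnott map
    turns the Dirac measure at [sigma] into the function [kappa(sigma) ^ y], and
    [kappa] sends the components of [artin a] in [Delta] and [Gamma] to
    [omega a] and [diamond a], so that both sides agree term by term.  The
    Riemann sums do converge, as an element of [Gam n], being trivial on the
    [P ^ n.+1]-torsion, has [kappa] congruent to 1 mod [P ^ n.+1]. *)

(** * Adic completions *)

Section Divisibility.
Variable R : comNzRingType.
Implicit Types m a b c d : R.

Lemma rdvd0 m : rdvd m 0.
Proof. by exists 0; rewrite mul0r. Qed.

Lemma rdvdD m a b : rdvd m a -> rdvd m b -> rdvd m (a + b).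
Proof. by move=> [c ->] [d ->]; exists (c + d); rewrite mulrDl. Qed.

Lemma rdvdN m a : rdvd m a -> rdvd m (- a).
Proof. by move=> [c ->]; exists (- c); rewrite mulNr. Qed.

Lemma rdvdMl m a c : rdvd m a -> rdvd m (c * a).
Proof. by move=> [d ->]; exists (c * d); rewrite mulrA. Qed.

Lemma rdvdMr m a c : rdvd m a -> rdvd m (a * c).
Proof. by rewrite mulrC; apply: rdvdMl. Qed.

Lemma rdvd_sum m (I : Type) (r : seq I) (D : pred I) (F : I -> R) :
  (forall i, D i -> rdvd m (F i)) -> rdvd m (\sum_(i <- r | D i) F i).
Proof. by move=> mF; apply: big_ind => //; [exact: rdvd0|exact: rdvdD]. Qed.

Lemma rdvd_exp_le m i j a : (i <= j)%N -> rdvd (m ^+ j) a -> rdvd (m ^+ i) a.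
Proof. by move=> /subnK <- [c ->]; exists (c * m ^+ (j - i)); rewrite exprD mulrA. Qed.

Lemma rdvd_expl m n a : rdvd m a -> rdvd (m ^+ n) (a ^+ n).
Proof. by move=> [c ->]; exists (c ^+ n); rewrite exprMn. Qed.

Lemma cong_refl m a : rdvd m (a - a).
Proof. by rewrite subrr; apply: rdvd0. Qed.

Lemma cong_sym m a b : rdvd m (a - b) -> rdvd m (b - a).
Proof. by move/rdvdN; rewrite opprB. Qed.

Lemma cong_trans m b a c : rdvd m (a - b) -> rdvd m (b - c) -> rdvd m (a - c).
Proof. by move=> /rdvdD h /h; rewrite addrA subrK. Qed.

Lemma congD m a b c d :
  rdvd m (a - b) -> rdvd m (c - d) -> rdvd m (a + c - (b + d)).
Proof. by move=> /rdvdD h /h; rewrite opprD addrACA. Qed.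

Lemma congB m a b c d :
  rdvd m (a - b) -> rdvd m (c - d) -> rdvd m (a - c - (b - d)).
Proof.
move=> ab /rdvdN /(rdvdD ab); congr (rdvd m _).
by ring.
Qed.

Lemma congM m a b c d :
  rdvd m (a - b) -> rdvd m (c - d) -> rdvd m (a * c - b * d).
Proof.
move=> /(rdvdMr c) ab /(rdvdMl b) cd.
by have := rdvdD ab cd; rewrite mulrBl mulrBr addrA subrK.
Qed.

Lemma congX m a b n : rdvd m (a - b) -> rdvd m (a ^+ n - b ^+ n).
Proof.
move=> ab; elim: n => [|n IH]; first exact: cong_refl.
by rewrite !exprS; apply: congM.
Qed.

Lemma cong_sum m (I : Type) (r : seq I) (D : pred I) (F G : I -> R) :
  (forall i, D i -> rdvd m (F i - G i)) ->
  rdvd m (\sum_(i <- r | D i) F i - \sum_(i <- r | D i) G i).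
Proof. by move=> FG; rewrite -sumrB; apply: rdvd_sum. Qed.

Lemma cong_prod m (I : Type) (r : seq I) (D : pred I) (F G : I -> R) :
  (forall i, D i -> rdvd m (F i - G i)) ->
  rdvd m (\prod_(i <- r | D i) F i - \prod_(i <- r | D i) G i).
Proof.
move=> FG; apply: (big_ind2 (fun a b => rdvd m (a - b))) => //.
  exact: cong_refl.
by move=> a b c d; exact: congM.
Qed.

(* Newton's congruence: raising to the power [p] gains one factor [x]. *)
Lemma congX_prime (x : R) p n a b : prime p -> rdvd x p%:R ->
  rdvd (x ^+ n.+1) (a - b) -> rdvd (x ^+ n.+2) (a ^+ p - b ^+ p).
Proof.
move=> p_pr xp ab; rewrite subrXX [x ^+ n.+2]exprS.
have : rdvd x (\sum_(j < p) a ^+ (p.-1 - j) * b ^+ j).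
  have xab : rdvd x (a - b) by rewrite -[x]expr1; apply: rdvd_exp_le ab.
  rewrite -[X in rdvd x X]subr0.
  apply: (@cong_trans _ (\sum_(j < p) b ^+ p.-1)).
    apply: cong_sum => j _.
    have -> : b ^+ p.-1 = b ^+ (p.-1 - j) * b ^+ j.
      by rewrite -exprD subnK // -ltnS prednK ?ltn_ord ?prime_gt0.
    by apply: congM (cong_refl _ _); apply: congX.
  by rewrite subr0 sumr_const card_ord -mulr_natl; apply: rdvdMr.
move: ab => [c ->] [d hd]; exists (c * d).
rewrite (_ : \sum_(j < p) _ = d * x); first by ring.
by rewrite -hd; apply: eq_bigr.
Qed.

Lemma congX_pow (x : R) p n a b : prime p -> rdvd x p%:R ->
  rdvd x (a - b) -> rdvd (x ^+ n.+1) (a ^+ (p ^ n) - b ^+ (p ^ n)).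
Proof.
move=> p_pr xp ab; elim: n => [|n IH]; first by rewrite !expr1.
by rewrite expnSr !exprM; apply: congX_prime.
Qed.

End Divisibility.

Lemma rdvd_morph (R S : comNzRingType) (f : {rmorphism R -> S}) a b :
  rdvd a b -> rdvd (f a) (f b).
Proof. by move=> [c ->]; exists (f c); rewrite rmorphM. Qed.

Section CompletionTheory.
Variables (R : comNzRingType) (x : R) (hx : ~ rdvd x 1).
Local Notation C := (completion hx).
Local Notation to_C := (to_completion hx).

Lemma completion_eq0 (u : adic_seq x) :
  (\pi_C u)%qT = 0 -> forall n, rdvd (x ^+ n) (u n).
Proof.
move=> u0; have := Quotient.idealrBE (adic_null hx) u 0.
by rewrite subr0 rmorph0 u0 eqxx => /asboolP.
Qed.

Lemma completion_eq0I (u : adic_seq x) :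
  (forall n, rdvd (x ^+ n) (u n)) -> (\pi_C u)%qT = 0.
Proof.
move=> u0; apply/eqP; rewrite -(rmorph0 \pi_C%qT) -Quotient.idealrBE subr0.
exact/asboolP.
Qed.

Lemma adic_seq_step (u : adic_seq x) n : rdvd (x ^+ n) (u n.+1 - u n).
Proof. by have /asboolP := valP u; apply. Qed.

Lemma adic_seq_cong (u : adic_seq x) m n : (m <= n)%N ->
  rdvd (x ^+ m) (u n - u m).
Proof.
move=> /subnK <-; elim: (n - m)%N => [|j IH]; first exact: cong_refl.
apply: cong_trans IH; rewrite addSn.
by apply: rdvd_exp_le (adic_seq_step _ _); rewrite leq_addl.
Qed.

(** The tail of [u] beyond [n] is [x ^+ n] times the explicit Cauchy sequence [v] built from
    quotients [e] of consecutive differences. These quotients are chosen, since [x] may be a zero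
    divisor. *)
Lemma pi_approx (u : adic_seq x) n :
  adic_close n (\pi_C u)%qT (to_C (u n)).
Proof.
have [e he] := choice (adic_seq_step u).
pose v m := \sum_(j < m) x ^+ j * e (n + j)%N.
have vC : v \in adic_cauchy x.
  apply/asboolP => m; exists (e (n + m)%N).
  by rewrite /v big_ord_recr [LHS]addrC addKr mulrC.
have vE m : x ^+ n * v m = u (n + m)%N - u n.
  rewrite /v; elim: m => [|m IH]; first by rewrite big_ord0 mulr0 addn0 subrr.
  rewrite big_ord_recr mulrDr IH /= mulrA -exprD mulrC -he addnS.
  by rewrite addrC addrA subrK.
exists (\pi_C (AdicSeq vC))%qT.
rewrite -[to_C x ^+ n]rmorphXn mulrC /= /to_completion -rmorphM -rmorphB.
apply/eqP; rewrite -subr_eq0 -rmorphB; apply/eqP/completion_eq0I => m.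
rewrite -[X in rdvd _ X]/(u m - u n - x ^+ n * v m) vE opprB addrA subrK.
by apply: cong_sym; apply: adic_seq_cong; rewrite leq_addl.
Qed.

Lemma adic_approx n (z : C) : exists a, adic_close n z (to_C a).
Proof.
have -> : z = (\pi_C (repr z))%qT by rewrite reprK.
by exists (repr z n); apply: pi_approx.
Qed.

(** Completing creates no new divisibility between elements of [R]: the [n]-th term of a
    representative of the quotient already serves modulo [x ^+ n]. *)
Lemma to_completion_dvd n a : rdvd (to_C x ^+ n) (to_C a) <-> rdvd (x ^+ n) a.
Proof.
split=> [|/(rdvd_morph to_C)]; last by rewrite rmorphXn.
case=> z; have -> : z = (\pi_C (repr z))%qT by rewrite reprK.
rewrite -rmorphXn /= /to_completion -rmorphM => /eqP.
rewrite -subr_eq0 -rmorphB => /eqP /completion_eq0 /(_ n).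
rewrite -[X in rdvd _ X]/(a - repr z n * x ^+ n) => /rdvdD.
move/(_ (repr z n * x ^+ n)); rewrite subrK; apply.
by exists (repr z n).
Qed.

Lemma adic_close_to n a b : adic_close n (to_C a) (to_C b) <-> rdvd (x ^+ n) (a - b).
Proof. by rewrite /adic_close -rmorphB; exact: to_completion_dvd. Qed.

Lemma adic_separated (z : C) : (forall n, rdvd (to_C x ^+ n) z) -> z = 0.
Proof.
have -> : z = (\pi_C (repr z))%qT by rewrite reprK.
move=> hz; apply: completion_eq0I => n; apply/to_completion_dvd.
have := cong_sym (pi_approx (repr z) n) => /rdvdD /(_ (hz n)).
by rewrite subrK.
Qed.

Lemma adic_close_eq (z t : C) : (forall n, adic_close n z t) -> z = t.
Proof. by move=> zt; apply/eqP; rewrite -subr_eq0; apply/eqP/adic_separated. Qed.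

(** A diagonal argument: an element [u n] of [R] approximating [z n] to order [n] gives a Cauchy
    sequence whose class is the limit. *)
Lemma adic_complete (z : nat -> C) :
  (forall n, adic_close n (z n.+1) (z n)) -> exists l, forall n, adic_close n l (z n).
Proof.
move=> hz; have [u hu] := choice (fun n => adic_approx n (z n)).
have uC : u \in adic_cauchy x.
  apply/asboolP => n; apply/adic_close_to.
  apply: cong_trans (hu n); apply: cong_trans (hz n).
  by apply: cong_sym; apply: rdvd_exp_le (hu n.+1).
exists (\pi_C (AdicSeq uC))%qT => n.
exact: cong_trans (pi_approx (AdicSeq uC) n) (cong_sym (hu n)).
Qed.

(** Separatedness makes limits unique, so the value picked by [adic_lim] can only be [l]. *)
Lemma adic_limE (u : nat -> C) l :
  (forall N, exists M, forall n, (M <= n)%N -> adic_close N (u n) l) ->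
  adic_lim u = l.
Proof.
move=> ul; rewrite /adic_lim; case: xgetP => [l' _ ul'|/(_ l) []//].
apply: adic_close_eq => N; have [[M hM] [M' hM']] := (ul N, ul' N).
apply: cong_trans (hM (maxn M M') (leq_maxl _ _)).
exact: cong_sym (hM' _ (leq_maxr _ _)).
Qed.

Lemma adic_residueP (z : C) : adic_close 1 z (to_C (adic_residue z)).
Proof.
rewrite /adic_residue; case: xgetP => [//|no].
by have [a /no] := adic_approx 1 z.
Qed.

Lemma adic_residue_cong (z : C) a :
  adic_close 1 z (to_C a) -> rdvd x (adic_residue z - a).
Proof.
move=> za; rewrite -[x in rdvd x _]expr1; apply/adic_close_to.
exact: cong_trans (cong_sym (adic_residueP z)) za.
Qed.

(** The inverse is the geometric series in [1 - z], which converges because [x] divides [1 - z]. *)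
Lemma adic_unit (z : C) : rdvd (to_C x) (1 - z) -> z \is a GRing.unit.
Proof.
move=> z1; pose w := 1 - z; pose s n := \sum_(j < n) w ^+ j.
have [l hl] : exists l, forall n, adic_close n l (s n).
  apply: adic_complete => n.
  rewrite /adic_close /s big_ord_recr [X in rdvd _ X]addrC addKr.
  exact: rdvd_expl.
suff lz : l * z = 1 by apply/unitrPr; exists l; rewrite mulrC.
apply: adic_close_eq => n.
have sz : s n * z = 1 - w ^+ n.
  have -> : z = 1 - w by rewrite opprB addrC subrK.
  rewrite -[1 in RHS](expr1n _ n) [RHS]subrXX mulrC; congr (_ * _).
  by apply: eq_bigr => j _; rewrite expr1n mul1r.
apply: (cong_trans (b := s n * z)); first exact: congM (hl n) (cong_refl _ _).
by rewrite sz [X in rdvd _ X]addrC addKr; apply: rdvdN; apply: rdvd_expl.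
Qed.

End CompletionTheory.

(** * Teichmuller lifts *)

Section Teichmuller.
Variables (R : comNzRingType) (x : R) (p : nat) (p_pr : prime p).
Variables (kappa : finFieldType) (red : {rmorphism R -> kappa}).
Hypothesis xp : rdvd x p%:R.
Hypothesis p_char : p \in [pchar kappa].
Hypothesis red_surj : forall a, exists w, red w = a.
Hypothesis red_ker : forall w, red w = 0 <-> rdvd x w.
Hypothesis separated : forall w : R, (forall n, rdvd (x ^+ n) w) -> w = 0.
Hypothesis complete : forall u : nat -> R,
  (forall n, rdvd (x ^+ n) (u n.+1 - u n)) ->
  exists l, forall n, rdvd (x ^+ n) (l - u n).

Local Notation q := #|kappa|.
Let f := logn p q.

Let q_gt1 : (1 < q)%N. Proof. exact: finNzRing_gt1. Qed.
Let qE : q = (p ^ f)%N. Proof. exact: (card_pprimeChar p_char). Qed.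
Let f_gt0 : (0 < f)%N. Proof. by move: q_gt1; rewrite qE; case: f. Qed.

Let red_eq w z : red w = red z -> rdvd x (w - z).
Proof. by move=> wz; apply/red_ker; rewrite rmorphB wz subrr. Qed.

Let cong_expq n w z : rdvd x (w - z) ->
  rdvd (x ^+ n.+1) (w ^+ (q ^ n) - z ^+ (q ^ n)).
Proof.
move=> /(congX_pow (f * n) p_pr xp); rewrite expnM -qE; apply: rdvd_exp_le.
by rewrite ltnS leq_pmull.
Qed.

Let fixed_expq n (w : R) : w ^+ q = w -> w ^+ (q ^ n) = w.
Proof. by move=> wq; elim: n => [|n IH]; rewrite ?expr1 // expnS exprM wq. Qed.

(** Both elements equal their own [q ^ n]-th powers, and raising to that power improves a congruence
    modulo [x] to one modulo [x ^+ n.+1]. *)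
Lemma teich_unique (w z : R) :
  w ^+ q = w -> z ^+ q = z -> red w = red z -> w = z.
Proof.
move=> wq zq /red_eq wz; apply/eqP; rewrite -subr_eq0; apply/eqP/separated => n.
by have := cong_expq n wz; rewrite !fixed_expq //; apply: rdvd_exp_le.
Qed.

(** For any lift [w] of [a], the powers [w ^+ (q ^ n)] all reduce to [a] and form a Cauchy sequence;
    their limit is fixed by the [q]-th power. *)
Lemma teich_exists a : a != 0 -> exists z : R, z ^+ q.-1 = 1 /\ red z = a.
Proof.
move=> a0; have [w wa] := red_surj a.
have red_pow n : red (w ^+ (q ^ n)) = a.
  rewrite rmorphXn wa.
  by elim: n => [|n IH]; rewrite ?expr1 // expnSr exprM IH expf_card.
have wq : rdvd x (w ^+ q - w).
  by apply: red_eq; rewrite -[q in LHS]expn1 red_pow wa.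
have [l hl] : exists l, forall n, rdvd (x ^+ n) (l - w ^+ (q ^ n)).
  apply: complete => n; rewrite expnS exprM.
  by apply: (rdvd_exp_le (leqnSn n)); apply: cong_expq.
have la : red l = a.
  have : rdvd x (l - w ^+ (q ^ 1)) by rewrite -[x]expr1.
  by move/red_ker; rewrite rmorphB red_pow => /subr0_eq.
have lq : l ^+ q = l.
  apply/eqP; rewrite -subr_eq0; apply/eqP/separated => n.
  apply: (cong_trans (b := w ^+ (q ^ n.+1))).
    by rewrite expnSr exprM; apply: congX.
  by apply: cong_sym; apply: rdvd_exp_le (hl n.+1).
(* [R] may have zero divisors, so [l] is not cancelled in [l ^+ q = l]. Instead [1 - e] is an
   idempotent divisible by [x], hence by every power of [x], hence zero. *)
exists l; split=> //; set e := l ^+ q.-1.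
have [r q2] : exists r, q = r.+2.
  by move: q_gt1; case: #|kappa| => [|[|r]] //; exists r.
have ee : e * e = e.
  by rewrite /e q2 /= -exprD -addSnnS exprD -q2 lq -exprS.
have xe : rdvd x (1 - e).
  apply/red_ker; rewrite rmorphB rmorph1 /e rmorphXn la.
  suff -> : a ^+ q.-1 = 1 by rewrite subrr.
  by apply: (mulfI a0); rewrite -exprS (prednK (ltnW q_gt1)) expf_card mulr1.
apply/eqP; rewrite eq_sym -subr_eq0; apply/eqP/separated => n.
suff -> : 1 - e = (1 - e) ^+ n.+1 by apply: (rdvd_exp_le (leqnSn n)); apply: rdvd_expl.
elim: n => [|n IH]; rewrite ?expr1 // exprS -IH mulrBl mul1r mulrBr mulr1 ee.
by rewrite subrr subr0.
Qed.

(** The equation [z ^+ q = z], unlike [z ^+ q.-1 = 1], also covers the lift of 0. *)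
Lemma teichP a : teich red a ^+ q = teich red a /\ red (teich red a) = a.
Proof.
rewrite /teich; case: eqP => [->|/eqP a0].
  by rewrite rmorph0 expr0n -(prednK (ltnW q_gt1)).
case: xgetP => [z _ [zq za]|no]; last by have [z /no] := teich_exists a0.
by split=> //; rewrite -(prednK (ltnW q_gt1)) exprS zq mulr1.
Qed.

Lemma teichX a : a != 0 -> teich red a ^+ q.-1 = 1.
Proof.
move=> a0; rewrite /teich (negPf a0).
case: xgetP => [z _ []//|no]; by have [z /no] := teich_exists a0.
Qed.

Lemma teichE a (z : R) : z ^+ q = z -> red z = a -> teich red a = z.
Proof. by move=> zq za; have [tq ta] := teichP a; apply: teich_unique; rewrite ?ta. Qed.

End Teichmuller.

(** * The local ring at [P] and its residue field *)

Section ApTheory.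
Variables (k : finFieldType) (P : {poly k}) (hP : monic_irreducible_poly P).
Local Notation Ap := (Ap hP).
Local Notation to_Ap := (to_Ap hP).
Local Notation Fp := {poly %/ P with hP}.

HB.instance Definition _ := GRing.isZmodMorphism.Build {poly k} Ap to_Ap
  (to_completion_is_zmod_morphism (prime_proper hP)).
HB.instance Definition _ := GRing.isMonoidMorphism.Build {poly k} Ap to_Ap
  (to_completion_is_monoid_morphism (prime_proper hP)).

Definition toFp (a : {poly k}) : Fp := in_qpoly P a.

Fact toFp_is_zmod_morphism : zmod_morphism toFp.
Proof. by move=> a b; rewrite /toFp rmorphB. Qed.
Fact toFp_is_monoid_morphism : monoid_morphism toFp.
Proof. by split=> [|a b]; rewrite /toFp ?in_qpoly1 // in_qpolyM. Qed.
HB.instance Definition _ :=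
  GRing.isZmodMorphism.Build {poly k} Fp toFp toFp_is_zmod_morphism.
HB.instance Definition _ :=
  GRing.isMonoidMorphism.Build {poly k} Fp toFp toFp_is_monoid_morphism.

Lemma rdvdpP (b a : {poly k}) : rdvd b a <-> (b %| a)%R.
Proof. by split=> /dvdpP. Qed.

Lemma toFp_eq0 a : toFp a = 0 <-> rdvd P a.
Proof.
rewrite rdvdpP Pdiv.Field.dvdpE; split=> [/(congr1 val) /= e|/Pdiv.Ring.rmodp_eq0P e].
  by apply/Pdiv.Ring.rmodp_eq0P; rewrite mk_monicE in e.
by apply: val_inj; rewrite /= mk_monicE.
Qed.

Lemma toFp_eq a b : toFp a = toFp b <-> rdvd P (a - b).
Proof.
rewrite -toFp_eq0 rmorphB /=; split=> [->|/subr0_eq //]; exact: subrr.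
Qed.

Lemma to_Ap_dvd n a : rdvd (to_Ap P ^+ n) (to_Ap a) <-> rdvd (P ^+ n) a.
Proof. exact: to_completion_dvd. Qed.

Lemma red_ApE (z : Ap) a : adic_close 1 z (to_Ap a) -> red_Ap z = toFp a.
Proof. by move=> /adic_residue_cong /toFp_eq. Qed.

Lemma red_to_Ap a : red_Ap (to_Ap a) = toFp a.
Proof. by apply: red_ApE; apply: cong_refl. Qed.

Lemma red_Ap_residue (z : Ap) : red_Ap z = toFp (adic_residue z).
Proof. by []. Qed.

Fact red_Ap_is_zmod_morphism : zmod_morphism (@red_Ap k P hP).
Proof.
move=> z t; rewrite !red_Ap_residue -rmorphB; apply: red_ApE.
by rewrite rmorphB; apply: congB; apply: adic_residueP.
Qed.
Fact red_Ap_is_monoid_morphism : monoid_morphism (@red_Ap k P hP).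
Proof.
split=> [|z t].
  by rewrite -(rmorph1 to_Ap) red_to_Ap rmorph1.
rewrite !red_Ap_residue -rmorphM; apply: red_ApE.
by rewrite rmorphM; apply: congM; apply: adic_residueP.
Qed.
HB.instance Definition _ :=
  GRing.isZmodMorphism.Build Ap Fp (@red_Ap k P hP) red_Ap_is_zmod_morphism.
HB.instance Definition _ :=
  GRing.isMonoidMorphism.Build Ap Fp (@red_Ap k P hP) red_Ap_is_monoid_morphism.

Lemma red_Ap_eq0 (z : Ap) : red_Ap z = 0 <-> rdvd (to_Ap P) z.
Proof.
have := adic_residueP z; rewrite /adic_close expr1 => zr.
rewrite red_Ap_residue toFp_eq0 -[X in rdvd X (adic_residue z)]expr1.
rewrite -to_Ap_dvd expr1.
by split=> [/(rdvdD zr)|/(rdvdD (cong_sym zr))]; rewrite subrK.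
Qed.

Lemma toFp_surj a : exists b, toFp b = a.
Proof.
exists (val a); apply: val_inj; apply: Pdiv.Ring.rmodp_small.
exact: (@size_mk_monic _ P a).
Qed.

Lemma red_Ap_surj (a : Fp) : exists z : Ap, red_Ap z = a.
Proof. by have [b <-] := toFp_surj a; exists (to_Ap b); rewrite red_to_Ap. Qed.

Lemma Ap_separated (w : Ap) : (forall n, rdvd (to_Ap P ^+ n) w) -> w = 0.
Proof. exact: adic_separated. Qed.

Lemma Ap_complete (u : nat -> Ap) :
  (forall n, rdvd (to_Ap P ^+ n) (u n.+1 - u n)) ->
  exists l, forall n, rdvd (to_Ap P ^+ n) (l - u n).
Proof. exact: adic_complete. Qed.

(** Multiplying by a lift of the inverse residue reduces to an element congruent to 1. *)
Lemma Ap_unitP (z : Ap) : red_Ap z != 0 -> z \is a GRing.unit.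
Proof.
move=> z0; have [t tz] := red_Ap_surj (red_Ap z)^-1.
have : t * z \is a GRing.unit.
  apply: adic_unit; apply/red_Ap_eq0.
  by rewrite rmorphB rmorph1 rmorphM /= tz mulVf // subrr.
by rewrite mulrC => /unitrPr [v zv]; apply/unitrPr; exists (t * v); rewrite mulrA.
Qed.

Lemma toFp_neq0 a : ~~ (P %| a) -> toFp a != 0.
Proof. by move=> Pa; apply/eqP => /toFp_eq0/rdvdpP; apply/negP. Qed.

Lemma to_Ap_unit a : ~~ (P %| a) -> to_Ap a \is a GRing.unit.
Proof. by move=> Pa; apply: Ap_unitP; rewrite red_to_Ap toFp_neq0. Qed.

Lemma P_neq0 : P != 0. Proof. exact: monic_neq0 hP.2. Qed.

Variables (p : nat) (p_char : p \in [pchar k]).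

Lemma pchar_residue : p \in [pchar Fp].
Proof. exact: rmorph_pchar toFp _ (rmorph_pchar (@polyC k) p_char). Qed.

Lemma pchar_Ap : p \in [pchar Ap].
Proof.
have := rmorph_pchar (@polyC k) p_char.
exact: (rmorph_pchar (to_completion (prime_proper hP))).
Qed.

Let p_pr : prime p. Proof. exact: pcharf_prime p_char. Qed.
Let Pp : rdvd (to_Ap P) p%:R.
Proof. by have /andP[_ /eqP ->] := pchar_Ap; apply: rdvd0. Qed.

Local Notation lift := (@lift_Ap k P hP).
Local Notation q := #|{: Fp}|.

Lemma lift_ApP a : lift a ^+ q = lift a /\ red_Ap (lift a) = a.
Proof.
exact: (teichP p_pr Pp pchar_residue red_Ap_surj red_Ap_eq0 Ap_separated Ap_complete).
Qed.

Lemma lift_ApE a z : z ^+ q = z -> red_Ap z = a -> lift a = z.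
Proof.
exact: (teichE p_pr Pp pchar_residue red_Ap_surj red_Ap_eq0 Ap_separated Ap_complete).
Qed.

Let pnat_q : [pchar Ap].-nat q.
Proof.
rewrite (card_pprimeChar pchar_residue) pnatX; apply/orP; left.
by rewrite pnatE // pchar_Ap.
Qed.

(** In characteristic [p] the roots of [z ^+ q = z] are stable under subtraction, so the
    multiplicative lift is also additive and embeds the residue field as a subring. *)
Fact lift_Ap_is_zmod_morphism : zmod_morphism lift.
Proof.
move=> a b; have [[la ra] [lb rb]] := (lift_ApP a, lift_ApP b).
apply: lift_ApE; last by rewrite rmorphB /= ra rb.
by rewrite (exprDn_pchar _ _ pnat_q) exprNn_pchar ?pnat_q // la lb.
Qed.

Fact lift_Ap_is_monoid_morphism : monoid_morphism lift.
Proof.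
split=> [|a b]; first by apply: lift_ApE; rewrite ?expr1n ?rmorph1.
have [[la ra] [lb rb]] := (lift_ApP a, lift_ApP b).
by apply: lift_ApE; rewrite ?exprMn ?la ?lb // rmorphM /= ra rb.
Qed.

(** The morphism structure depends on the hypothesis [p_char], hence the existential form. *)
Lemma lift_Ap_morph : exists f : {rmorphism Fp -> Ap}, f =1 lift.
Proof.
pose m1 := GRing.isZmodMorphism.Build Fp Ap lift lift_Ap_is_zmod_morphism.
pose m2 := GRing.isMonoidMorphism.Build Fp Ap lift lift_Ap_is_monoid_morphism.
pose f : {rmorphism Fp -> Ap} := HB.pack lift m1 m2.
by exists f.
Qed.

End ApTheory.

Lemma rdvdzP (b a : int) : rdvd b a <-> (b %| a)%Z.
Proof. by split=> /dvdzP. Qed.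

Lemma ffactz_prod (r n : nat) : (r ^_ n)%:Z = \prod_(j < n) (r%:Z - j%:R).
Proof.
elim: n => [|n IH]; first by rewrite big_ord0 ffactn0.
rewrite big_ord_recr -IH ffactnSr PoszM /=.
have [le_nr|lt_rn] := leqP n r; last by rewrite ffact_small // !mul0r.
by rewrite -subzn // natz.
Qed.

(** * Powers of one-units with p-adic exponents *)

Section PadicBinomial.
Variables (p : nat) (p_pr : prime p).
Local Notation Zp := (padic_int p_pr).
Local Notation to_Zp := (to_completion (padic_proper p_pr)).

(** Dividing by [n!] costs exactly its [p]-adic valuation in precision; this is the source of the
    [logn p n!] terms below. *)
Lemma fact_mul_dvd n i (d : int) :
  rdvd (p%:Z ^+ (i + logn p n`!)) (n`!%:Z * d) -> rdvd (p%:Z ^+ i) d.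
Proof.
move=> /rdvdzP; rewrite dvdzE abszX abszM /= => h.
apply/rdvdzP; rewrite dvdzE abszX /=.
have [->|d0] := posnP `|d|%N; first exact: dvdn0.
rewrite pfactor_dvdn // -(leq_add2r (logn p n`!)).
rewrite [X in (_ <= X)%N]addnC -lognM ?fact_gt0 // -pfactor_dvdn //.
by rewrite muln_gt0 fact_gt0.
Qed.

Lemma padic_nat_approx M (y : Zp) : exists r : nat, adic_close M y r%:R.
Proof.
have [a ha] := adic_approx M y.
exists `|(a %% p%:Z ^+ M)%Z|%N; rewrite -(rmorph_nat to_Zp).
have pM : (p%:Z ^+ M != 0 :> int) by rewrite expf_neq0 // eqz_nat -lt0n prime_gt0.
apply: cong_trans ha _; apply/adic_close_to; rewrite natz gez0_abs ?modz_ge0 //.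
exists (a %/ p%:Z ^+ M)%Z; rewrite {1}(divz_eq a (p%:Z ^+ M)); ring.
Qed.

Lemma padic_nat_close M (r s : nat) :
  adic_close M (r%:R : Zp) s%:R <-> rdvd (p%:Z ^+ M) (r%:Z - s%:Z).
Proof.
rewrite -!(rmorph_nat to_Zp) !natz; exact: adic_close_to.
Qed.

Lemma to_Zp_nat (n : nat) : to_Zp n%:Z = n%:R.
Proof. by rewrite -[n%:Z]natz rmorph_nat. Qed.

Let cong_binom (y : Zp) n i r s :
  adic_close (i + logn p n`!) y r%:R -> adic_close (i + logn p n`!) y s%:R ->
  rdvd (p%:Z ^+ i) ('C(r, n)%:Z - 'C(s, n)%:Z).
Proof.
move=> yr ys; apply: (@fact_mul_dvd n).
rewrite mulrBr -!PoszM -![(n`! * _)%N]mulnC !bin_ffact !ffactz_prod.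
apply: cong_prod => j _; apply: congB (cong_refl _ _).
apply/padic_nat_close; exact: cong_trans (cong_sym yr) ys.
Qed.

(** A binomial coefficient of [y] exists as the limit of the integers ['C(r i, n)], where [r i]
    approximates [y] closely enough to absorb the division by [n!]. *)
Lemma padic_binomP (y : Zp) n :
  n`!%:R * padic_binom y n = \prod_(j < n) (y - j%:R).
Proof.
rewrite /padic_binom; case: xgetP => [b _ //|no]; exfalso.
have [r hr] := choice (fun i => padic_nat_approx (i + logn p n`!) y).
have [b hb] : exists b : Zp, forall i, adic_close i b 'C(r i, n)%:R.
  apply: adic_complete => i; apply/padic_nat_close.
  apply: (@cong_binom y); last exact: hr.
  by apply: rdvd_exp_le (hr i.+1); rewrite leq_add2r.
apply: (no b); apply: adic_close_eq => i.
apply: (cong_trans (b := n`!%:R * 'C(r i, n)%:R)).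
  exact: congM (cong_refl _ _) (hb i).
rewrite -natrM mulnC bin_ffact -to_Zp_nat ffactz_prod rmorph_prod.
apply: cong_prod => j _; rewrite rmorphB rmorph_nat /= (to_Zp_nat (r i)).
apply: congB (cong_refl _ _); apply: cong_sym.
by apply: rdvd_exp_le (hr i); apply: leq_addr.
Qed.

Lemma padic_binom_residue (y : Zp) n r :
  adic_close (1 + logn p n`!) y r%:R ->
  rdvd p%:Z (adic_residue (padic_binom y n) - 'C(r, n)%:Z).
Proof.
move=> yr; set b := padic_binom y n.
have [c hc] := adic_approx (1 + logn p n`!) b.
apply: (cong_trans (b := c)).
  by apply: adic_residue_cong; apply: rdvd_exp_le hc.
rewrite -[p%:Z]expr1; apply: (@fact_mul_dvd n).
rewrite mulrBr; apply/(@adic_close_to _ _ (padic_proper p_pr)).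
rewrite rmorphM /= (to_Zp_nat n`!).
apply: (cong_trans (b := n`!%:R * b)).
  exact: congM (cong_refl _ _) (cong_sym hc).
rewrite padic_binomP -PoszM mulnC bin_ffact ffactz_prod rmorph_prod.
apply: cong_prod => j _; rewrite rmorphB rmorph_nat /= (to_Zp_nat r).
exact: congB yr (cong_refl _ _).
Qed.

End PadicBinomial.

Section OneUnitPowers.
Variables (k : finFieldType) (P : {poly k}) (hP : monic_irreducible_poly P).
Variables (p : nat) (p_pr : prime p) (p_char : p \in [pchar k]).
Local Notation Ap := (Ap hP).
Local Notation to_Ap := (to_Ap hP).
Local Notation Zp := (padic_int p_pr).
Implicit Types (u v : Ap) (y : Zp).

Let natr_cong (a : int) (b : nat) : rdvd p%:Z (a - b%:Z) -> a%:~R = b%:R :> Ap.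
Proof.
move=> [c h]; apply/eqP; rewrite -subr_eq0 -[b%:R]/((b%:Z)%:~R) -intrB h.
by rewrite intrM [X in _ * X](pcharf0 (pchar_Ap hP p_char)) mulr0.
Qed.

(** Modulo [P ^+ N] only the terms of index below [N] survive, and their coefficients modulo [p]
    depend on [y] to finite precision. Thus [u ^ y] is close to an ordinary power, with a precision
    [M] uniform in [u]. *)
Lemma Ap_pow_approx y N : exists M, forall (r : nat) u,
  adic_close M y r%:R -> rdvd (to_Ap P) (u - 1) ->
  adic_close N (Ap_pow u y) (u ^+ r).
Proof.
(* For [j < N], the factorial of [j] divides that of [N], so this one precision fixes all the
   coefficients modulo [p]. *)
exists (1 + logn p N`!)%N => r u yr u1; set w := u - 1.
pose s n := \sum_(j < n) (adic_residue (padic_binom y j))%:~R * w ^+ j.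
have [l hl] : exists l, forall n, adic_close n l (s n).
  apply: adic_complete => n.
  rewrite /adic_close /s big_ord_recr [X in rdvd _ X]addrC addKr.
  by apply: rdvdMl; apply: rdvd_expl.
have -> : Ap_pow u y = l.
  apply: adic_limE => n; exists n => m le_nm; apply: cong_sym.
  exact: rdvd_exp_le (hl m).
apply: cong_trans (hl N) _.
have -> : s N = \sum_(j < N) 'C(r, j)%:R * w ^+ j.
  apply: eq_bigr => j _; congr (_ * _); apply: natr_cong.
  apply: padic_binom_residue; apply: rdvd_exp_le yr.
  rewrite leq_add2l dvdn_leq_log ?fact_gt0 //.
  by rewrite -(bin_fact (ltnW (ltn_ord j))) mulnCA dvdn_mulr.
have wE j : 'C(r, j)%:R * w ^+ j = (1 ^+ (r - j) * w ^+ j) *+ 'C(r, j).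
  by rewrite expr1n mul1r mulr_natl.
(* Padding the binomial expansion to [N + r.+1] terms puts it and the truncation at [N] over a
   common range. *)
have -> : u ^+ r = \sum_(j < N + r.+1) 'C(r, j)%:R * w ^+ j.
  rewrite -[u](subrK 1) -/w addrC exprDn.
  rewrite (big_ord_widen (N + r.+1)
    (fun j => (1 ^+ (r - j) * w ^+ j) *+ 'C(r, j))) ?leq_addl //.
  rewrite big_mkcond; apply: eq_bigr => j _; rewrite wE.
  by case: ltnP => // rj; rewrite bin_small // mulr0n.
rewrite (big_ord_widen (N + r.+1) (fun j => 'C(r, j)%:R * w ^+ j)) ?leq_addr //.
rewrite big_mkcond; apply: cong_sum => j _; case: ltnP => [_|Nj].
  exact: cong_refl.
rewrite sub0r; apply/rdvdN/rdvdMl; by apply: (rdvd_exp_le Nj); exact: rdvd_expl.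
Qed.

Lemma Ap_pow_cong N y u v :
  rdvd (to_Ap P) (u - 1) -> rdvd (to_Ap P) (v - 1) -> adic_close N u v ->
  adic_close N (Ap_pow u y) (Ap_pow v y).
Proof.
move=> u1 v1 uv; have [M hM] := Ap_pow_approx y N.
have [r yr] := padic_nat_approx M y.
apply: cong_trans (hM r u yr u1) _.
apply: cong_trans (congX r uv) _.
exact: cong_sym (hM r v yr v1).
Qed.

(** Take natural approximations [r] of [y] and [s] of [- y]. A high power of [p] divides [r + s], so
    [u ^+ (r + s)] is close to 1; multiplying by [v ^+ r] leaves [u ^+ s] close to [v ^+ r]. *)
Lemma Ap_pow_inv y u v :
  rdvd (to_Ap P) (u - 1) -> rdvd (to_Ap P) (v - 1) -> v * u = 1 ->
  Ap_pow v y = Ap_pow u (- y).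
Proof.
move=> u1 v1 vu; apply: adic_close_eq => N.
have [M1 hM1] := Ap_pow_approx y N.
have [M2 hM2] := Ap_pow_approx (- y) N.
(* [M1] and [M2] serve the two approximations, and [N] makes [u ^+ (p ^ M)] congruent to 1 modulo
   [P ^+ N]. *)
pose M := (M1 + M2 + N)%N.
have [r yr] := padic_nat_approx M y.
have [s ys] := padic_nat_approx M (- y).
have M1r : adic_close M1 y r%:R.
  by apply: rdvd_exp_le yr; rewrite /M -addnA leq_addr.
have M2s : adic_close M2 (- y) s%:R.
  by apply: rdvd_exp_le ys; rewrite /M addnAC leq_addl.
apply: cong_trans (hM1 r v M1r v1) _; apply: cong_sym.
apply: cong_trans (hM2 s u M2s u1) _.
have : (p ^ M %| r + s)%N.
  have : rdvd (p%:Z ^+ M) ((r + s)%:Z - 0%:Z).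
    apply/(padic_nat_close p_pr); rewrite natrD; apply: cong_sym.
    by have := congD yr ys; rewrite subrr.
  by rewrite subr0 => /rdvdzP; rewrite dvdzE abszX.
move=> /dvdnP [t rs].
have urs : rdvd (to_Ap P ^+ N) (u ^+ (r + s) - 1).
  rewrite rs mulnC exprM -[1](expr1n _ t); apply: congX.
  have Pp : rdvd (to_Ap P) p%:R.
    by rewrite (pcharf0 (pchar_Ap hP p_char)); apply: rdvd0.
  have := congX_pow M p_pr Pp u1; rewrite expr1n; apply: rdvd_exp_le.
  by rewrite leqW // leq_addl.
have /(rdvdMl (v ^+ r)) := urs.
by rewrite mulrBr mulr1 exprD mulrA -exprMn vu expr1n mul1r.
Qed.

End OneUnitPowers.

(** * The Carlitz module and Frobenius elements *)

Section CarlitzCoefficients.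
Variable k : finFieldType.
Local Notation q := #|k|.
Implicit Types a b Q : {poly k}.

(* The coefficients of [tau ^ j] in [Phi_(theta ^ i)]. *)
Fixpoint carlitz_mon (i j : nat) : {poly k} :=
  if i is i'.+1 then
    'X * carlitz_mon i' j + (if j is j'.+1 then carlitz_mon i' j' ^+ q else 0)
  else (j == 0)%:R.

(** The coefficients are kept in [{poly k}] rather than in its fraction field, so that they can be
    reduced modulo a prime. *)
Definition carlitz_coef a (j : nat) : {poly k} :=
  \sum_(i < size a) a`_i *: carlitz_mon i j.

Lemma expD_card (R : comNzRingType) (f : {rmorphism k -> R}) n (x y : R) :
  (x + y) ^+ (q ^ n) = x ^+ (q ^ n) + y ^+ (q ^ n).
Proof.
have [p p_pr p_char] := finPcharP k.
apply: exprDn_pchar; rewrite (card_pprimeChar p_char) -expnM pnatX.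
by rewrite pnatE // (rmorph_pchar f p_char).
Qed.

Lemma sum_exp_card (R : comNzRingType) (f : {rmorphism k -> R}) (I : Type)
    (r : seq I) (D : pred I) (F : I -> R) :
  (\sum_(i <- r | D i) F i) ^+ q = \sum_(i <- r | D i) F i ^+ q.
Proof.
apply: (big_morph (fun x : R => x ^+ q)) => [x y|].
  by have := expD_card f 1 x y; rewrite expn1.
by rewrite expr0n gtn_eqF // ltnW // finNzRing_gt1.
Qed.

Lemma polyD_expq (x y : {poly k}) : (x + y) ^+ q = x ^+ q + y ^+ q.
Proof. by have := expD_card (@polyC k) 1 x y; rewrite expn1. Qed.

Lemma expf_card_pow n (c : k) : c ^+ (q ^ n) = c.
Proof. by elim: n => [|n IH]; rewrite ?expr1 // expnS exprM expf_card. Qed.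

(* [Phi_(theta ^ i.+1)] is [Phi_(theta ^ i) Phi_theta] as well as
   [Phi_theta Phi_(theta ^ i)]. *)
Lemma carlitz_mon_recr i j :
  carlitz_mon i.+1 j =
  'X ^+ (q ^ j) * carlitz_mon i j + (if j is j'.+1 then carlitz_mon i j' else 0).
Proof.
have q_gt0 : (0 < q)%N by exact: ltnW (finNzRing_gt1 k).
elim: i j => [|i IH] [|j].
- by rewrite /= expr1.
- rewrite /= !mulr0 !add0r; case: j => [|j] /=; first by rewrite expr1n.
  by rewrite expr0n gtn_eqF.
- by rewrite IH /= expr1.
transitivity ('X * carlitz_mon i.+1 j.+1 + carlitz_mon i.+1 j ^+ q); first by [].
rewrite [in LHS]IH [in LHS]IH polyD_expq exprMn -exprM -expnSr.
case: j => [|j]; rewrite [in RHS]/= ?expr0n ?(gtn_eqF q_gt0) ?mulr0n.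
  by move: 'X^(q ^ 1) (carlitz_mon i 0 ^+ q) => A B; ring.
by move: 'X^(q ^ _) (carlitz_mon i j.+1 ^+ q) (carlitz_mon i j ^+ q) => A B D; ring.
Qed.

Lemma carlitz_mon_gt i j : (i < j)%N -> carlitz_mon i j = 0.
Proof.
elim: i j => [|i IH] [|j] //=; rewrite ltnS => lt_ij.
rewrite !IH ?mulr0 ?add0r ?expr0n ?gtn_eqF //; last exact: ltnW.
exact: ltnW (finNzRing_gt1 k).
Qed.

Lemma carlitz_mon_diag i : carlitz_mon i i = 1.
Proof.
by elim: i => [|i IH] //=; rewrite IH carlitz_mon_gt // mulr0 add0r expr1n.
Qed.

Lemma carlitz_mon0 i : carlitz_mon i 0 = 'X^i.
Proof. by elim: i => [|i IH] //=; rewrite IH addr0 exprS. Qed.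

Lemma carlitz_coef0 a : carlitz_coef a 0 = a.
Proof.
rewrite -[RHS]coefK poly_def; apply: eq_bigr => i _.
by rewrite carlitz_mon0.
Qed.

Lemma carlitz_coef_lead a : carlitz_coef a (size a).-1 = (lead_coef a)%:P.
Proof.
rewrite /carlitz_coef lead_coefE; case sa: (size a) => [|n].
  have -> : a = 0 by apply/eqP; rewrite -size_poly_eq0 sa.
  by rewrite big_ord0 coef0 polyC0.
rewrite big_ord_recr big1 /= => [|i _]; last by rewrite carlitz_mon_gt ?scaler0.
by rewrite add0r carlitz_mon_diag alg_polyC.
Qed.

(** This compares the coefficients of [tau ^ j.+1] in the two products of [Phi_theta] and [Phi_a],
    which commute. *)
Lemma carlitz_coef_comm a j :
  'X * carlitz_coef a j.+1 + carlitz_coef a j ^+ q =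
  'X ^+ (q ^ j.+1) * carlitz_coef a j.+1 + carlitz_coef a j.
Proof.
have powq : carlitz_coef a j ^+ q = \sum_(i < size a) a`_i *: carlitz_mon i j ^+ q.
  rewrite /carlitz_coef (sum_exp_card (@polyC k)).
  by apply: eq_bigr => i _; rewrite exprZn expf_card.
rewrite powq /carlitz_coef !mulr_sumr -!big_split; apply: eq_bigr => i _ /=.
rewrite -!scalerAr -!scalerDr; congr (_ *: _).
exact: (carlitz_mon_recr i j.+1).
Qed.

(** Otherwise every element of the residue field of [Q], of order [q ^ deg Q], would be a root of a
    polynomial of degree [q ^ j], which is smaller. *)
Lemma expX_sub_ndvd Q j : irreducible_poly Q -> Q \is monic ->
  (0 < j < (size Q).-1)%N -> ~~ (Q %| 'X ^+ (q ^ j) - 'X).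
Proof.
move=> Qirr Qm /andP[j0 jd]; apply/negP => Qj.
pose hQ : monic_irreducible_poly Q := (Qirr, Qm).
(* The divisibility passes from ['X] to every [b], as the [q ^ j]-th power is additive and fixes the
   constants. *)
have Qb b : Q %| b ^+ (q ^ j) - b.
  elim/poly_ind: b => [|b c IH].
    by rewrite subr0 expr0n expn_eq0 gtn_eqF ?(ltnW (finNzRing_gt1 k)) ?dvdp0.
  rewrite (expD_card (@polyC k)) exprMn -polyC_exp expf_card_pow.
  rewrite opprD addrACA subrr addr0.
  by apply/rdvdpP; apply: congM; apply/rdvdpP.
pose F := {poly %/ Q with hQ}.
have Fq (z : F) : z ^+ (q ^ j) = z.
  have [b <-] := toFp_surj z.
  by rewrite -rmorphXn; apply/toFp_eq/rdvdpP.
have q_gt1 := finNzRing_gt1 k.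
have qj_gt1 : (1 < q ^ j)%N by rewrite -(expn0 q) ltn_exp2l.
pose f : {poly F} := 'X^(q ^ j) - 'X.
have sf : size f = (q ^ j).+1.
  by rewrite size_polyDl size_polyXn // size_polyN size_polyX ltnS.
have f0 : f != 0 by rewrite -size_poly_eq0 sf.
have fr : all (root f) (enum F).
  by apply/allP => z _; rewrite /root !hornerE Fq subrr.
have := max_poly_roots f0 fr (enum_uniq F).
rewrite sf ltnS -cardE card_qfpoly leq_exp2l //.
by rewrite leqNgt jd.
Qed.

(* Reducing the commutation relation mod [Q], an induction on [j]: the first
   nonzero coefficient [c_j] would satisfy [c_j * (theta ^ (q ^ j) - theta) = 0]. *)
Lemma carlitz_coef_dvd Q j : irreducible_poly Q -> Q \is monic ->
  (j < (size Q).-1)%N -> Q %| carlitz_coef Q j.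
Proof.
move=> Qirr Qm; elim: j => [|j IH] jd; first by rewrite carlitz_coef0.
have Qj := IH (ltnW jd).
have : Q %| carlitz_coef Q j.+1 * ('X ^+ (q ^ j.+1) - 'X).
  have -> : carlitz_coef Q j.+1 * ('X ^+ (q ^ j.+1) - 'X) =
      carlitz_coef Q j ^+ q - carlitz_coef Q j.
    have := carlitz_coef_comm Q j => h.
    rewrite mulrBr ![carlitz_coef Q j.+1 * _]mulrC.
    by apply/eqP; rewrite subr_eq addrAC eq_sym subr_eq addrC h.
  rewrite dvdp_sub // -(prednK (ltnW (finNzRing_gt1 k))) exprS dvdp_mulr //.
rewrite Gauss_dvdpl // coprimep_sym; last first.
  by rewrite coprimep_sym irreducible_poly_coprime // expX_sub_ndvd.
Qed.

Lemma carlitz_iterE i N : (i < N)%N ->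
  iter i (fun f => carlitz_theta k \Po f) 'X =
  \sum_(j < N) tofrac (carlitz_mon i j) *: 'X^(q ^ j).
Proof.
elim: i N => [|i IH] [|N] // ltiN.
  rewrite big_ord_recl big1 => [|j _]; last by rewrite /= tofrac0 scale0r.
  by rewrite /= tofrac1 scale1r expr1 addr0.
rewrite iterS (IH N.+1 (ltnW ltiN)) /carlitz_theta comp_polyD comp_polyZ comp_polyX.
(* The top term vanishes since [i < N]; dropping it makes room for the shift of indices caused by
   the [q]-th power. *)
rewrite comp_Xn_poly [X in X ^+ q]big_ord_recr /= carlitz_mon_gt //.
rewrite tofrac0 scale0r addr0.
rewrite (sum_exp_card (@polyC {fraction {poly k}} \o @tofrac {poly k} \o @polyC k)).
rewrite scaler_sumr big_ord_recl [RHS]big_ord_recl /= -addrA; congr (_ + _).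
  by rewrite addr0 tofracM scalerA.
rewrite -big_split; apply: eq_bigr => j _ /=.
rewrite tofracD tofracM tofracXn scalerDl scalerA; congr (_ + _).
by rewrite exprZn -exprM -expnSr.
Qed.

Lemma carlitzE a :
  carlitz a = \sum_(j < size a) tofrac (carlitz_coef a j) *: 'X^(q ^ j).
Proof.
transitivity (\sum_(i < size a) \sum_(j < size a)
    tofrac (a`_i *: carlitz_mon i j) *: ('X^(q ^ j) : {poly {fraction {poly k}}})).
  apply: eq_bigr => i _; rewrite (carlitz_iterE (ltn_ord i)) scaler_sumr.
  by apply: eq_bigr => j _; rewrite scalerA -tofracM mul_polyC.
rewrite exchange_big; apply: eq_bigr => j _ /=.
by rewrite /carlitz_coef rmorph_sum scaler_suml.
Qed.

Lemma size_carlitz a : a != 0 -> size (carlitz a) = (q ^ (size a).-1).+1.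
Proof.
move=> a0; have sa : size a = (size a).-1.+1 by rewrite prednK ?size_poly_gt0.
rewrite carlitzE sa big_ord_recr /= carlitz_coef_lead addrC.
have lead0 : tofrac (lead_coef a)%:P != 0.
  by rewrite tofrac_eq0 polyC_eq0 lead_coef_eq0.
have sl : size (tofrac (lead_coef a)%:P *: 'X^(q ^ (size a).-1)
    : {poly {fraction {poly k}}}) = (q ^ (size a).-1).+1.
  by rewrite size_scale // size_polyXn.
rewrite size_polyDl ?sl // ltnS (leq_trans (size_sum _ _ _)) //.
apply/bigmax_leqP => j _; rewrite (leq_trans (size_scale_leq _ _)) // size_polyXn.
by rewrite ltn_exp2l ?finNzRing_gt1.
Qed.

Variables (Omega : closedFieldType).
Variable iota : {rmorphism {fraction {poly k}} -> Omega}.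

Lemma carlitz_eval_coef a (x : Omega) :
  carlitz_eval iota a x =
  \sum_(j < size a) iota (tofrac (carlitz_coef a j)) * x ^+ (q ^ j).
Proof.
rewrite /carlitz_eval carlitzE rmorph_sum horner_sum; apply: eq_bigr => j _ /=.
by rewrite map_polyZ map_polyXn !hornerE.
Qed.

Lemma carlitz_eval0 (x : Omega) : carlitz_eval iota 0 x = 0.
Proof. by rewrite carlitz_eval_coef size_poly0 big_ord0. Qed.

Lemma carlitz_eval1 (x : Omega) : carlitz_eval iota 1 x = x.
Proof.
rewrite carlitz_eval_coef size_poly1 big_ord1 carlitz_coef0.
by rewrite tofrac1 rmorph1 mul1r expr1.
Qed.

Lemma carlitz_evalM a b (x : Omega) :
  carlitz_eval iota (b * a) x = carlitz_eval iota b (carlitz_eval iota a x).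
Proof.
elim/poly_ind: b => [|b c IH].
  by rewrite mul0r !carlitz_eval0.
rewrite mulrDl mulrAC !carlitz_evalD !carlitz_evalMX IH; congr (_ + _).
rewrite mul_polyC carlitz_evalZ; set u := carlitz_eval iota a x.
by rewrite -[in RHS]alg_polyC carlitz_evalZ carlitz_eval1.
Qed.

Lemma carlitz_evalB a (x y : Omega) :
  carlitz_eval iota a (x - y) = carlitz_eval iota a x - carlitz_eval iota a y.
Proof.
have itB i : iter i (carlitz_step iota) (x - y) =
    iter i (carlitz_step iota) x - iter i (carlitz_step iota) y.
  by elim: i => [|i IH] //; rewrite !iterS IH raddfB.
rewrite !(carlitz_evalE iota _ (leqnn (size a))) -sumrB; apply: eq_bigr => j _.
by rewrite -mulrBr itB.
Qed.

Lemma carlitz_evalr0 a : carlitz_eval iota a 0 = 0.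
Proof. by have := carlitz_evalB a 0 0; rewrite !subrr. Qed.

End CarlitzCoefficients.

(** * Galois action on torsion points *)

Section FrobeniusAction.
Variables (k : finFieldType) (P : {poly k}) (hP : monic_irreducible_poly P).
Variables (Omega : closedFieldType).
Variable iota : {rmorphism {fraction {poly k}} -> Omega}.
Local Notation q := #|k|.
Local Notation Ginf := (Ginf P iota).
Local Notation Finf := (Finf P iota).
Local Notation Gam := (@Gam k P Omega iota).
Local Notation toF := (A_to_Finf P iota).
Local Notation to_Ap := (to_Ap hP).
Implicit Types (a b : {poly k}) (x : Finf) (s t : Ginf).

Fact A_to_Finf_is_zmod_morphism : zmod_morphism toF.
Proof. by move=> a b; apply: val_inj; rewrite /= tofracB rmorphB. Qed.
Fact A_to_Finf_is_monoid_morphism : monoid_morphism toF.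
Proof.
by split=> [|a b]; apply: val_inj; rewrite /= ?tofrac1 ?rmorph1 // tofracM rmorphM.
Qed.
HB.instance Definition _ :=
  GRing.isZmodMorphism.Build {poly k} Finf toF A_to_Finf_is_zmod_morphism.
HB.instance Definition _ :=
  GRing.isMonoidMorphism.Build {poly k} Finf toF A_to_Finf_is_monoid_morphism.

(** The Carlitz action inside [Finf], written with coefficients in [{poly k}] so that it can be
    reduced modulo a prime above [Q]. *)
Definition carlitz_act a x : Finf :=
  \sum_(j < size a) toF (carlitz_coef a j) * x ^+ (q ^ j).

Lemma val_carlitz_act a x : val (carlitz_act a x) = carlitz_eval iota a (val x).
Proof.
rewrite carlitz_eval_coef rmorph_sum; apply: eq_bigr => j _.
by rewrite rmorphM rmorphXn.
Qed.

Lemma torsionP a (z : Omega) : torsion iota a z <-> carlitz_eval iota a z = 0.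
Proof. by split=> /rootP. Qed.

Lemma torsion_act a b x :
  torsion iota a (val x) -> torsion iota a (val (carlitz_act b x)).
Proof.
move=> /torsionP ax; apply/torsionP.
by rewrite val_carlitz_act -carlitz_evalM mulrC carlitz_evalM ax carlitz_evalr0.
Qed.

Lemma torsionB a (y z : Omega) :
  torsion iota a y -> torsion iota a z -> torsion iota a (y - z).
Proof.
move=> /torsionP ay /torsionP az; apply/torsionP.
by rewrite carlitz_evalB ay az subrr.
Qed.

Lemma torsion_Finf n (z : Omega) : torsion iota (P ^+ n.+1) z ->
  exists2 x : Finf, val x = z & val x \in Fn P iota n.
Proof.
move=> tz; have zn : z \in Fn P iota n by apply: mem_gen_subfield; right.
have zF : z \in Finf_pred P iota by apply/asboolP; exists n.
by exists (MkFinf zF).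
Qed.

(** For monic [a], the additive polynomial of [Phi_a] is monic with coefficients in [{poly k}]. *)
Lemma torsion_integral a x : a \is monic -> torsion iota a (val x) ->
  integralOver toF x.
Proof.
move=> am /torsionP; rewrite -val_carlitz_act => ax.
have a0 := monic_neq0 am.
have sa : size a = (size a).-1.+1 by rewrite prednK ?size_poly_gt0.
exists (\sum_(j < size a) carlitz_coef a j *: 'X^(q ^ j)).
  rewrite sa big_ord_recr /= carlitz_coef_lead (monicP am) scale1r addrC.
  rewrite monicE lead_coefDl ?lead_coefXn // size_polyXn ltnS.
  rewrite (leq_trans (size_sum _ _ _)) //; apply/bigmax_leqP => j _.
  by rewrite (leq_trans (size_scale_leq _ _)) // size_polyXn ltn_exp2l ?finNzRing_gt1.
apply/rootP; rewrite rmorph_sum horner_sum.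
transitivity (carlitz_act a x); last by apply: val_inj; rewrite ax rmorph0.
by apply: eq_bigr => j _ /=; rewrite map_polyZ map_polyXn !hornerE.
Qed.

(** [Finf] is generated over the base field by the [P]-power torsion. *)
Lemma Ginf_eq s t :
  (forall n x, torsion iota (P ^+ n.+1) (val x) -> s x = t x) -> s = t.
Proof.
move=> st; have Gst n : Gam n (s^-1 * t)%g.
  apply: Gam_torsion => x tx; rewrite -[LHS]/(s^-1%g (t x)) -(st n) //.
  exact: (gal_inv_funP _).1.
apply: val_inj; apply/funext => x; have /asboolP [n xn] := valP x.
have := Gst n x xn; rewrite -[LHS]/(s^-1%g (t x)) => e.
by rewrite -[in LHS]e; apply: (gal_inv_funP _).2.
Qed.

Section PrimeAbove.
Variables (Q : {poly k}) (J : set Finf).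
Hypotheses (Qpl : places P Q) (JQ : is_prime_above Q J).

Let JO x : J x -> integralOver toF x. Proof. by case: JQ => -[JO _] _ _ _ _ /JO. Qed.
Let JD x y : J x -> J y -> J (x + y). Proof. by case: JQ => _ + _ _ _; apply. Qed.
Let JM x y : integralOver toF x -> J y -> J (x * y).
Proof. by case: JQ => _ _ + _ _; apply. Qed.
Let JA a : J (toF a) <-> Q %| a. Proof. by case: JQ => _ _ _ _; apply. Qed.
Let JN x : J x -> J (- x).
Proof.
by rewrite -mulN1r; apply: JM; apply: integral_opp; apply: integral1.
Qed.
Let J0 : J 0. Proof. by rewrite -(rmorph0 toF); apply/JA. Qed.

Lemma integral_exp n x : integralOver toF x -> integralOver toF (x ^+ n).
Proof.
move=> xi; elim: n => [|n IH]; first exact: integral1.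
by rewrite exprS; apply: integral_mul.
Qed.

Let Jsum (I : Type) (r : seq I) (D : pred I) (F : I -> Finf) :
  (forall i, D i -> J (F i)) -> J (\sum_(i <- r | D i) F i).
Proof. by move=> JF; apply: big_ind. Qed.

(** The leading coefficient of [Phi_Q] is 1 and all the others are divisible by [Q]. *)
Lemma carlitz_act_modJ x : integralOver toF x ->
  J (carlitz_act Q x - x ^+ (q ^ (size Q).-1)).
Proof.
case: Qpl => Qm Qirr _ xi.
rewrite /carlitz_act -(prednK (n := size Q)) ?size_poly_gt0 ?monic_neq0 //.
rewrite big_ord_recr /= carlitz_coef_lead (monicP Qm) polyC1 rmorph1 mul1r addrK.
apply: Jsum => j _; rewrite mulrC; apply: JM; first exact: integral_exp.
by apply/JA; apply: carlitz_coef_dvd.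
Qed.

(* If [x <> 0] is killed by [Phi_a], then dividing [Phi_a(x) = 0] by [x] shows
   that [a] is a multiple of [x]. *)
Lemma torsion_modJ a x : a \is monic -> ~~ (Q %| a) ->
  torsion iota a (val x) -> J x -> x = 0.
Proof.
move=> am Qa tx Jx; apply/eqP; apply: contraNT Qa => x0; apply/JA.
have ax : carlitz_act a x = 0.
  by apply: val_inj; rewrite val_carlitz_act rmorph0; apply/torsionP.
have xi := JO Jx.
move: ax; rewrite /carlitz_act.
rewrite -(prednK (n := size a)) ?size_poly_gt0 ?monic_neq0 // big_ord_recl.
rewrite /= carlitz_coef0 expn0 expr1.
have q_gt0 : (0 < q)%N by exact: ltnW (finNzRing_gt1 k).
under eq_bigr => j _ do
  rewrite -(prednK (n := (q ^ _)%N)) ?expn_gt0 ?q_gt0 // exprSr mulrA.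
rewrite -mulr_suml -mulrDl => /eqP; rewrite mulf_eq0 (negPf x0) orbF addr_eq0.
move=> /eqP ->; apply: JN; apply: Jsum => j _.
(* After one [x] has been cancelled the exponent is still positive, so a factor [x], which lies in
   [J], remains. *)
have -> : (q ^ bump 0 j).-1 = (q ^ bump 0 j).-2.+1.
  rewrite prednK // -subn1 subn_gt0 -(expn0 q) ltn_exp2l ?finNzRing_gt1 //.
rewrite exprSr mulrA; apply: JM => //; apply: integral_mul.
  exact: integral_id.
exact: integral_exp.
Qed.

End PrimeAbove.

Lemma places_coprime Q : places P Q -> coprimep Q P.
Proof.
case=> Qm Qirr QP; rewrite irreducible_poly_coprime //; apply/negP => QdP.
have := apply_irredp hP.1 _ QdP; rewrite gtn_eqF ?Qirr.1 // => /(_ isT).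
by rewrite eqp_monic ?hP.2 // => /eqP.
Qed.

(** Both sides are congruent to [x ^+ (q ^ deg Q)] modulo [J], and their difference is a torsion
    point, which [torsion_modJ] forces to be zero. *)
Lemma frobenius_torsion Q s n x : places P Q -> is_frobenius Q s ->
  torsion iota (P ^+ n) (val x) -> s x = carlitz_act Q x.
Proof.
move=> Qpl [J JQ sJ] tx; have Pm : P ^+ n \is monic by rewrite monic_exp ?hP.2.
have xi := torsion_integral Pm tx; case: (Qpl) => Qm Qirr QP.
apply/eqP; rewrite -subr_eq0; apply/eqP.
have [JO JD JM _ JA] := JQ.
apply: (torsion_modJ JQ Pm).
- rewrite -irreducible_poly_coprime //.
  by apply: coprimep_expr; apply: places_coprime.
- rewrite rmorphB; apply: torsionB; first exact: torsion_gal.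
  exact: torsion_act.
- rewrite -(subrKA (x ^+ (q ^ (size Q).-1))); apply: JD; first exact: sJ.
  rewrite -opprB -mulN1r; apply: JM; last exact: carlitz_act_modJ.
  by apply: integral_opp; apply: integral1.
Qed.

Variable kappa : Ginf -> Ap hP.
Hypothesis kappa_cycl : is_cyclotomic_char kappa.

(** Surjectivity of [kappa] gives some [t] with [kappa t = Q]; it acts on torsion as [Phi_Q], as
    does [s], so [s = t]. *)
Lemma frobenius_kappa Q s : places P Q -> is_frobenius Q s -> kappa s = to_Ap Q.
Proof.
move=> Qpl Qs; have [_ _ surj act] := kappa_cycl.
have QP : ~~ (P %| Q).
  rewrite -irreducible_poly_coprime; last exact: hP.1.
  by rewrite coprimep_sym; apply: places_coprime.
have [t tQ] := (surj (to_Ap Q)).1 (to_Ap_unit hP QP).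
rewrite -tQ; congr (kappa _); apply: Ginf_eq => n x tx.
rewrite (frobenius_torsion Qpl Qs tx); apply: val_inj; rewrite val_carlitz_act.
by symmetry; apply: act tx; rewrite tQ; apply: cong_refl.
Qed.

(** The derivative of [Phi_a] is the nonzero constant [a], so [Phi_a] has [q ^ deg a] distinct
    roots, too many for a nonzero [Phi_b] of smaller degree. *)
Lemma torsion_eq0 a b : a != 0 -> (size b < size a)%N ->
  (forall z : Omega, torsion iota a z -> torsion iota b z) -> b = 0.
Proof.
move=> a0 ba ab; apply/eqP/negPn/negP => b0.
have [r fr] := closed_field_poly_normal (map_poly iota (carlitz a)).
have ca0 : carlitz a != 0 by rewrite -size_poly_eq0 size_carlitz.
have fa0 : map_poly iota (carlitz a) != 0 by rewrite map_poly_eq0.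
have ca_sep : separable_poly (\prod_(z <- r) ('X - z%:P)).
  rewrite -(@eqp_separable _ (map_poly iota (carlitz a))); last first.
    by rewrite fr eqp_scale // lead_coef_eq0.
  rewrite separable_map separable_poly.unlock deriv_carlitz.
  by rewrite -alg_polyC coprimepZr ?coprimep1 ?tofrac_eq0.
have ur : uniq r by rewrite -separable_prod_XsubC.
have fb0 : map_poly iota (carlitz b) != 0.
  by rewrite map_poly_eq0 -size_poly_eq0 size_carlitz.
have br : all (root (map_poly iota (carlitz b))) r.
  apply/allP => z zr; apply: ab; rewrite /torsion /= fr rootZ ?lead_coef_eq0 //.
  by rewrite root_prod_XsubC.
have := max_poly_roots fb0 br ur.
rewrite size_map_poly size_carlitz // ltnS.
have : size (map_poly iota (carlitz a)) = (size r).+1.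
  by rewrite fr size_scale ?lead_coef_eq0 // size_prod_XsubC.
rewrite size_map_poly size_carlitz // => -[<-].
rewrite leq_exp2l ?finNzRing_gt1 // leqNgt.
by rewrite -ltnS !prednK ?size_poly_gt0 // ba.
Qed.

(** If [a] approximates [kappa s], then [Phi_(a - 1)] kills the [P ^+ n.+1]-torsion. So does the
    remainder of [a - 1] modulo [P ^+ n.+1], which is therefore zero. *)
Lemma Gam_kappa n s : Gam n s -> adic_close n.+1 (kappa s) 1.
Proof.
move=> sn; have [_ _ _ act] := kappa_cycl.
have [a sa] := adic_approx n.+1 (kappa s).
apply: (cong_trans sa); rewrite -[1](rmorph1 to_Ap); apply/adic_close_to.
apply/rdvdpP; rewrite /dvdp; apply/eqP.
have Pn0 : P ^+ n.+1 != 0 by rewrite expf_neq0 ?P_neq0.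
apply: (@torsion_eq0 (P ^+ n.+1)) => //; first by rewrite ltn_modpN0.
move=> z tz; apply/torsionP.
have [x xz xn] := torsion_Finf tz.
have tx : torsion iota (P ^+ n.+1) (val x) by rewrite xz.
have a1 : carlitz_eval iota (a - 1) z = 0.
  have := act s n.+1 a x sa tx; rewrite (sn x xn) xz => e.
  rewrite carlitz_evalD -scaleN1r carlitz_evalZ carlitz_eval1 -e.
  by rewrite polyCN polyC1 tofracN tofrac1 rmorphN rmorph1 mulN1r subrr.
have := a1; rewrite {1}(divp_eq (a - 1) (P ^+ n.+1)) carlitz_evalD carlitz_evalM.
move/torsionP: tz => ->.
by rewrite carlitz_evalr0 add0r.
Qed.

Lemma kappa_Gam0_one s : Gam 0 s -> rdvd (to_Ap P) (kappa s - 1).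
Proof. by move=> /Gam_kappa; rewrite /adic_close expr1. Qed.

End FrobeniusAction.

(** * The Euler product *)

Section EulerFactors.
Variable R : nzRingType.
Implicit Types (c : R) (f : pseries R).

Lemma ps_coefM f g n : (f * g) n = \sum_(i < n.+1) f i * g (n - i)%N.
Proof. by []. Qed.

Lemma ps_monom_mull c d f n :
  (ps_monom c d * f) n = if (d <= n)%N then c * f (n - d)%N else 0.
Proof.
rewrite ps_coefM; case: leqP => [le_dn|lt_nd].
  have dn : (d < n.+1)%N by [].
  rewrite (bigD1 (Ordinal dn)) //= eqxx mulr1n big1 ?addr0 // => i.
  by rewrite -val_eqE /= => /negPf ->; rewrite mulr0n mul0r.
rewrite big1 // => i _ /=.
by rewrite ltn_eqF ?mulr0n ?mul0r // (leq_ltn_trans _ lt_nd) // -ltnS.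
Qed.

Lemma ps_monom_mulr c d f n :
  (f * ps_monom c d) n = if (d <= n)%N then f (n - d)%N * c else 0.
Proof.
rewrite ps_coefM; case: leqP => [le_dn|lt_nd].
  have dn : (n - d < n.+1)%N by rewrite ltnS leq_subr.
  rewrite (bigD1 (Ordinal dn)) //= subKn // eqxx mulr1n big1 ?addr0 // => i.
  rewrite -val_eqE /= => ni; suff /negPf -> : (n - i)%N != d by rewrite mulr0n mulr0.
  by apply: contraNneq ni => <-; rewrite subKn // -ltnS.
rewrite big1 // => i _ /=.
by rewrite ltn_eqF ?mulr0n ?mulr0 // (leq_ltn_trans _ lt_nd) // leq_subr.
Qed.

(** The inverse is the geometric series [f]. It is two-sided even in a noncommutative ring, as [c]
    commutes with its own powers. *)
Lemma euler_factor_unit c d : (0 < d)%N -> 1 - ps_monom c d \is a GRing.unit.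
Proof.
move=> d0; pose f : pseries R := PSeries (fun n => c ^+ (n %/ d) *+ (d %| n)%N).
have f1 n : f n = (n == 0%N)%:R + if (d <= n)%N then c * f (n - d)%N else 0.
  have [le_dn|lt_nd] := leqP d n; rewrite /f /=.
    rewrite gtn_eqF ?(leq_trans d0) // add0r -{1 2}(subnK le_dn).
    by rewrite dvdn_addl // divnDr // divnn d0 addn1 exprS mulrnAr.
  case: n lt_nd => [|n] lt_nd; first by rewrite div0n dvdn0 addr0.
  by rewrite gtnNdvd ?addr0.
have comm n : c * f n = f n * c by rewrite /f /= mulrnAr mulrnAl -exprS exprSr.
apply/unitrP; exists f; split; apply: pseriesP => n.
  rewrite mulrBr mulr1 -[LHS]/(f n - (f * ps_monom c d) n) ps_monom_mulr f1.
  by case: leqP; rewrite ?comm ?addrK ?subr0 ?addr0.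
rewrite mulrBl mul1r -[LHS]/(f n - (ps_monom c d * f) n) ps_monom_mull f1.
by case: leqP; rewrite ?addrK ?subr0 ?addr0.
Qed.

End EulerFactors.

Section GroupRingUnits.
Variables (G : groupType) (R : nzRingType).

Lemma group_ring_mulU (a b : G) :
  (<< a >> : group_ring G R) * (<< b >> : group_ring G R) = << (a * b)%g >>.
Proof.
rewrite -[LHS]/(gr_mul (R := R) << a >> << b >>) /gr_mul !msuppU oner_eq0.
by rewrite !big_seq_fset1 !mcoeffUU mulr1.
Qed.

End GroupRingUnits.

(** * Smooth polynomials and finite Euler products *)

Section SmoothPolynomials.
Variable k : finFieldType.
Implicit Types (a b Q : {poly k}) (s : seq {poly k}).

Definition smooth s a :=
  `[< forall Q, Q \is monic -> irreducible_poly Q -> Q %| a -> Q \in s >].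

Lemma monic_irreducible_divisor a : (1 < size a)%N ->
  exists2 Q, Q \is monic /\ irreducible_poly Q & Q %| a.
Proof.
have [n] := ubnP (size a); elim: n => // n IH in a *; rewrite ltnS => an a1.
have a0 : a != 0 by rewrite -size_poly_gt0 ltnW.
have [[d [da d1 ad]]|no] :=
    pselect (exists d, [/\ d %| a, size d != 1%N & ~~ (d %= a)]).
  have d0 : d != 0 by apply: contraNneq a0 => d0; rewrite d0 dvd0p in da.
  have sd : (size d < size a)%N.
    by rewrite ltn_neqAle dvdp_leq // andbT dvdp_size_eqp.
  have d2 : (1 < size d)%N by rewrite ltn_neqAle eq_sym d1 size_poly_gt0.
  have [Q Qirr Qd] := IH d (leq_trans sd an) d2.
  by exists Q => //; apply: dvdp_trans da.
have lc0 : (lead_coef a)^-1 != 0 by rewrite invr_eq0 lead_coef_eq0.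
exists ((lead_coef a)^-1 *: a); last by rewrite dvdpZl.
split; first by rewrite monicE lead_coefZ mulVf // lead_coef_eq0.
split; first by rewrite size_scale.
move=> d d1; rewrite dvdpZr // => da; apply: (@eqp_trans _ a).
  by apply/negPn/negP => ad; apply: no; exists d.
by rewrite eqp_sym eqp_scale.
Qed.

Lemma irreducible_dvdM Q a b : irreducible_poly Q ->
  Q %| a * b -> (Q %| a) || (Q %| b).
Proof.
move=> Qirr Qab; case: (boolP (Q %| a)) => //= Qa.
by move: Qab; rewrite Gauss_dvdpr // irreducible_poly_coprime.
Qed.

Lemma monic_irreducible_eq Q Q' : Q \is monic -> Q' \is monic ->
  irreducible_poly Q -> irreducible_poly Q' -> Q' %| Q -> Q' = Q.
Proof.
move=> Qm Q'm Qirr Q'irr /(apply_irredp Qirr); rewrite gtn_eqF ?Q'irr.1 //.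
by move=> /(_ isT); rewrite eqp_monic // => /eqP.
Qed.

Lemma smooth_consM s Q b : Q \is monic -> irreducible_poly Q ->
  smooth (Q :: s) (Q * b) = smooth (Q :: s) b.
Proof.
move=> Qm Qirr; apply/asboolP/asboolP => sm Q' Q'm Q'irr Q'd.
  by apply: sm => //; rewrite dvdp_mull.
have /orP[Q'Q|Q'b] := irreducible_dvdM Q'irr Q'd; last exact: sm.
by rewrite (monic_irreducible_eq Qm Q'm Qirr Q'irr Q'Q) mem_head.
Qed.

Lemma smooth_cons s Q a : Q \is monic -> irreducible_poly Q -> Q \notin s ->
  smooth (Q :: s) a && ~~ (Q %| a) = smooth s a.
Proof.
move=> Qm Qirr Qs; apply/andP/asboolP => [[/asboolP sm Qa] Q' Q'm Q'irr Q'd|sm].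
  have := sm Q' Q'm Q'irr Q'd; rewrite inE => /orP[/eqP Q'Q|//].
  by rewrite -Q'Q Q'd in Qa.
split; last by apply: contra Qs => /sm; apply.
by apply/asboolP => Q' Q'm Q'irr Q'd; rewrite inE sm ?orbT.
Qed.

Lemma smooth_nil a : a \is monic -> smooth [::] a -> a = 1.
Proof.
move=> am /asboolP sm; have [a1|a1] := leqP (size a) 1.
  rewrite [a](size1_polyC a1) in am *; congr _%:P; move: am.
  by rewrite monicE lead_coefC => /eqP.
by have [Q [Qm Qirr] /(sm _ Qm Qirr)] := monic_irreducible_divisor a1.
Qed.

Section EulerProduct.
Variables (G : groupType) (g : {poly k} -> G) (D : pred {poly k}).
Hypothesis g1 : g 1 = 1%g.
Hypothesis gM : forall a b, D a -> D b -> g (a * b) = (g a * g b)%g.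

(** The expansion of the Euler product over [s]. The map [g] is multiplicative only on [D] because
    it will be the inverse Artin symbol, meaningful only for polynomials prime to [P]. *)
Definition smooth_series s : pseries (group_ring G int) :=
  PSeries (fun n => \sum_(a : {poly_(n.+1) k} |
    [&& val a \is monic, size (val a) == n.+1 & smooth s (val a)]) << g (val a) >>).

Lemma smooth_series_nil : smooth_series [::] = 1.
Proof.
apply: pseriesP => -[|n] /=.
  rewrite (big_pred1 (npolyp 1 1)) => [|a]; first by rewrite npolypK ?size_poly1 // g1.
  rewrite [RHS]/= -[RHS]val_eqE /= npolypK ?size_poly1 //.
  apply/and3P/eqP => [[am _]|->].
    exact: smooth_nil.
  split; [exact: monic1|by rewrite size_poly1|apply/asboolP => Q _ Qirr Q1].
  have := dvdp_leq (oner_neq0 _) Q1; rewrite size_poly1 leqNgt.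
  by case: Qirr => ->.
rewrite big1 // => a /and3P[am /eqP sa asm]; move: sa.
by rewrite (smooth_nil am asm) size_poly1.
Qed.

(* Multiplying by the Euler factor at [Q] removes the multiples of [Q]. *)
Lemma smooth_series_cons Q s :
  Q \is monic -> irreducible_poly Q -> Q \notin s -> D Q ->
  (forall a, a \is monic -> smooth (Q :: s) a -> D a) ->
  (1 - ps_monom (<< g Q >> : group_ring G int) (size Q).-1) *
    smooth_series (Q :: s) = smooth_series s.
Proof.
move=> Qm Qirr Qs DQ Dsm; set d := (size Q).-1.
have dQ : size Q = d.+1 by rewrite prednK // size_poly_gt0 monic_neq0.
apply: pseriesP => n; rewrite mulrBl mul1r.
rewrite -[LHS]/(smooth_series _ n - (ps_monom _ _ * smooth_series (Q :: s)) n).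
rewrite ps_monom_mull /=; apply/eqP; rewrite subr_eq addrC.
(* The multiples [Q * b] of [Q] match the shifted series through [b]; the other terms are exactly
   the [s]-smooth ones. *)
rewrite (bigID (fun a : {poly_(n.+1) k} => Q %| val a)) /=; apply/eqP.
congr (_ + _); last first.
  apply: eq_bigl => a; rewrite -(smooth_cons _ Qm Qirr Qs).
  by case: (_ \is monic) => //; case: (_ == _).
have [le_dn|lt_nd] := leqP d n; last first.
  rewrite big1 // => a /andP[/and3P[am /eqP sa _] Qa].
  have := dvdp_leq (monic_neq0 am) Qa.
  by rewrite sa dQ ltnS leqNgt lt_nd.
rewrite mulr_sumr.
pose f (b : {poly_((n - d).+1) k}) : {poly_(n.+1) k} := npolyp n.+1 (Q * val b).
pose f' (a : {poly_(n.+1) k}) : {poly_((n - d).+1) k} := npolyp (n - d).+1 (val a %/ Q).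
have fE (b : {poly_((n - d).+1) k}) : val (f b) = Q * val b.
  rewrite /= npolypK // (leq_trans (size_polyMleq _ _)) // dQ.
  rewrite addSn /= (leq_trans (n := d + (n - d).+1)) ?leq_add2l ?size_npoly //.
  by rewrite addnS subnKC.
have f'K (b : {poly_((n - d).+1) k}) : f' (f b) = b.
  apply: val_inj; rewrite /f' fE mulKp ?monic_neq0 // /= npolypK //.
rewrite (reindex_onto f f') /=; last first.
  move=> a /andP[/and3P[am /eqP sa _] Qa]; apply: val_inj; rewrite fE.
  rewrite /f' /= npolypK; first by rewrite mulrC divpK.
  by rewrite size_divp ?monic_neq0 // dQ /= sa subSn.
apply: eq_big => b; last first.
  move=> /andP[/andP[/and3P[fm _ fs] _] _].
  rewrite fE in fm fs; rewrite monicMl // in fm; rewrite smooth_consM // in fs.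
  by rewrite -!/(val _) fE gM ?group_ring_mulU //; apply: Dsm.
rewrite f'K eqxx andbT -!/(val _) fE dvdp_mulr // andbT monicMl // smooth_consM //.
case bm : (val b \is monic) => //=; congr (_ && _).
rewrite size_monicM ?monic_neq0 // dQ addSn /= -[RHS](eqn_add2l d) addnS subnKC //.
Qed.

Lemma euler_product s : uniq s ->
  (forall Q, Q \in s -> [/\ Q \is monic, irreducible_poly Q & D Q]) ->
  (forall a, a \is monic -> smooth s a -> D a) ->
  \prod_(Q <- s) (1 - ps_monom (<< g Q >> : group_ring G int) (size Q).-1)^-1 =
  smooth_series s.
Proof.
elim: s => [|Q s IH]; first by rewrite big_nil smooth_series_nil.
move=> /= /andP[Qs us] sP Dsm; have [Qm Qirr DQ] := sP Q (mem_head _ _).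
rewrite big_cons IH //; first last.
- move=> a am /asboolP sm; apply: Dsm => //; apply/asboolP => R Rm Rirr Ra.
  by rewrite inE sm ?orbT.
- by move=> R Rs; apply: sP; rewrite inE Rs orbT.
rewrite -(smooth_series_cons Qm Qirr Qs DQ Dsm) mulKr //.
by apply: euler_factor_unit; rewrite -subn1 subn_gt0 Qirr.1.
Qed.

End EulerProduct.

End SmoothPolynomials.

Section GroupRingSums.
Variables (G : groupType) (V : pzRingType) (F : G -> V).

(** The linear extension of [F] to the group ring may be computed from any expression of [z], even
    one in which some [g i] coincide. *)
Lemma malg_sum (I : Type) (r : seq I) (D : pred I) (g : I -> G)
    (z : {malg int[G]}) : z = \sum_(i <- r | D i) << g i >> ->
  \sum_(x <- msupp z) (mcoeff x z)%:~R * F x = \sum_(i <- r | D i) F (g i).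
Proof.
pose phi (z : {malg int[G]}) := \sum_(x <- msupp z) (mcoeff x z)%:~R * F x.
have phiE (d : {fset G}) (t : {malg int[G]}) : (msupp t `<=` d)%fset ->
    phi t = \sum_(x <- d) (mcoeff x t)%:~R * F x.
  move=> td; apply: big_fset_incl => // x _ /mcoeff_outdom ->.
  by rewrite mul0r.
move=> ->; rewrite -/(phi _) (big_morph phi (id1 := 0) (op1 := +%R)).
- apply: eq_bigr => i _.
  by rewrite (phiE _ _ msuppU_le) big_seq_fset1 mcoeffUU mul1r.
- move=> t u; rewrite (phiE _ _ (msuppD_le _ _)).
  rewrite (phiE _ t (fsubsetUl _ (msupp u))) (phiE _ u (fsubsetUr (msupp t) _)).
  rewrite -big_split; apply: eq_bigr => x _ /=.
  by rewrite mcoeffD intrD mulrDl.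
- by rewrite /phi msupp0 big_seq_fset0.
Qed.

End GroupRingSums.

(** * Artin symbols and the coefficients of the Stickelberger series *)

Section StickelbergerSeries.
Variable k : finFieldType.
Variables (P : {poly k}) (hP : monic_irreducible_poly P).
Variables (Omega : closedFieldType).
Variable iota : {rmorphism {fraction {poly k}} -> Omega}.
Local Notation Ginf := (Ginf P iota).
Local Notation Ap := (Ap hP).
Local Notation to_Ap := (to_Ap hP).
Implicit Types (a b : {poly k}) (s t : Ginf).

Variable kappa : Ginf -> Ap.
Hypothesis kappa_cycl : is_cyclotomic_char kappa.

Let kappaM : {morph kappa : s t / (s * t)%g >-> s * t}.
Proof. by case: kappa_cycl. Qed.
Let kappa_inj : injective kappa. Proof. by case: kappa_cycl. Qed.
Let kappa_unit s : kappa s \is a GRing.unit.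
Proof. by case: kappa_cycl => _ _ surj _; apply/surj; exists s. Qed.

Lemma kappa1 : kappa 1%g = 1.
Proof. by apply: (mulrI (kappa_unit 1%g)); rewrite -kappaM mulg1 mulr1. Qed.

Lemma kappaV s : kappa s^-1%g = (kappa s)^-1.
Proof.
by apply: (mulrI (kappa_unit s)); rewrite -kappaM mulgV kappa1 mulrV.
Qed.

Lemma kappaX s n : kappa (s ^+ n)%g = kappa s ^+ n.
Proof. by elim: n => [|n IH]; rewrite ?kappa1 // expgS exprS kappaM IH. Qed.

(** Defining the Artin symbol through [kappa] makes it multiplicative at once; [frobenius_artin]
    identifies it with the Frobenius at each prime. *)
Definition artin a : Ginf := xget 1%g [set s | kappa s = to_Ap a].

Lemma kappa_artin a : ~~ (P %| a) -> kappa (artin a) = to_Ap a.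
Proof.
move=> Pa; rewrite /artin; case: xgetP => [//|no].
by case: kappa_cycl => _ _ surj _; have [s /no] := (surj _).1 (to_Ap_unit hP Pa).
Qed.

Lemma artinV1 : (artin 1)^-1%g = 1%g.
Proof.
apply: kappa_inj; rewrite kappaV kappa_artin ?rmorph1 ?invr1 ?kappa1 //.
by rewrite dvdp1 gtn_eqF // hP.1.1.
Qed.

Lemma ndvd_PM a b : ~~ (P %| a) -> ~~ (P %| b) -> ~~ (P %| a * b).
Proof.
move=> Pa Pb; apply/negP => /(irreducible_dvdM hP.1).
by rewrite (negPf Pa) (negPf Pb).
Qed.

Lemma artinVM a b : ~~ (P %| a) -> ~~ (P %| b) ->
  (artin (a * b))^-1%g = ((artin a)^-1 * (artin b)^-1)%g.
Proof.
move=> Pa Pb; apply: kappa_inj; rewrite kappaM !kappaV !kappa_artin ?ndvd_PM //.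
by rewrite rmorphM invrM ?to_Ap_unit // mulrC.
Qed.

Variable Fr : {poly k} -> Ginf.
Hypothesis Fr_prop : forall Q, places P Q -> is_frobenius Q (Fr Q).

Lemma places_ndvd Q : places P Q -> ~~ (P %| Q).
Proof.
move=> Qpl; rewrite -irreducible_poly_coprime; last exact: hP.1.
by rewrite coprimep_sym; apply: places_coprime Qpl.
Qed.

Lemma frobenius_artin Q : places P Q -> Fr Q = artin Q.
Proof.
move=> Qpl; apply: kappa_inj; rewrite kappa_artin ?places_ndvd //.
exact: frobenius_kappa kappa_cycl _ _ Qpl (Fr_prop Qpl).
Qed.

Lemma Theta_coef n : Theta Fr n =
  \sum_(a : {poly_(n.+1) k} |
      [&& val a \is monic, size (val a) == n.+1 & ~~ (P %| val a)])
    << (artin (val a))^-1%g >>.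
Proof.
pose T : pseries (group_ring Ginf int) := PSeries (fun n =>
  \sum_(a : {poly_(n.+1) k} |
      [&& val a \is monic, size (val a) == n.+1 & ~~ (P %| val a)])
    << (artin (val a))^-1%g >>).
pose E Q : pseries (group_ring Ginf int) :=
  (1 - ps_monom (<< (Fr Q)^-1%g >> : group_ring Ginf int) (size Q).-1)^-1.
have prodE (m : nat) : exists s0 : seq {poly k}, {in s0, forall Q, places P Q} /\
    forall s : seq {poly k}, uniq s -> {in s, forall Q, places P Q} ->
      {subset s0 <= s} -> (\prod_(Q <- s) E Q) m = T m.
  (* Only the primes of degree at most [m] can divide a polynomial of degree [m]. *)
  exists [seq val c | c <- enum {: {poly_(m.+1) k}} & `[< places P (val c) >]].
  split=> [_ /mapP[a + ->]|s us spl s0s].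
    by rewrite mem_filter => /andP[/asboolP].
  pose D := [pred a | ~~ (P %| a)].
  have -> : \prod_(Q <- s) E Q = \prod_(Q <- s)
      (1 - ps_monom (<< (artin Q)^-1%g >> : group_ring Ginf int) (size Q).-1)^-1.
    by apply: eq_big_seq => Q /spl Qpl; rewrite /E frobenius_artin.
  have PD a : a \is monic -> smooth s a -> D a.
    move=> am /asboolP sm; apply/negP => Pa.
    by have /spl [] := sm P hP.2 hP.1 Pa.
  rewrite (euler_product (D := D) artinV1 artinVM us _ PD); last first.
    by move=> Q /spl Qpl; split; [case: Qpl|case: Qpl|apply: places_ndvd].
  apply: eq_bigl => a; case am: (val a \is monic) => //=.
  case: eqP => //= sa; apply/idP/idP => [/PD|Pa]; first exact.
  apply/asboolP => Q Qm Qirr Qa; apply: s0s; apply/mapP.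
  have Qs : (size Q <= m.+1)%N by rewrite -sa dvdp_leq // monic_neq0.
  exists (npolyp m.+1 Q); last by rewrite /= npolypK.
  rewrite mem_filter mem_enum andbT /= npolypK //; apply/asboolP; split=> //.
  by move=> QP; rewrite -QP Qa in Pa.
suff -> : Theta Fr = T by [].
apply: pseriesP => m; rewrite /Theta /ps_prod.
(* [T] shows that a limit exists; any other limit agrees with it, as seen on a finite set of places
   containing both thresholds. *)
case: xgetP => [F _ FP|no]; last by case: (no T) => m'; exact: prodE.
have [[s1 [s1pl s1E]] [s2 [s2pl s2E]]] := (FP m, prodE m).
pose s := undup (s1 ++ s2).
have spl : {in s, forall Q, places P Q}.
  by move=> Q; rewrite mem_undup mem_cat => /orP[/s1pl|/s2pl].
rewrite -(s1E s) ?undup_uniq // => [|Q Qs1]; last by rewrite mem_undup mem_cat Qs1.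
by rewrite s2E ?undup_uniq // => Q Qs2; rewrite mem_undup mem_cat Qs2 orbT.
Qed.

End StickelbergerSeries.

(** * The Sinnott map *)

Section RiemannSums.
Variables (k : finFieldType) (p : nat) (p_pr : prime p) (p_char : p \in [pchar k]).
Variables (P : {poly k}) (hP : monic_irreducible_poly P).
Variables (Omega : closedFieldType).
Variable iota : {rmorphism {fraction {poly k}} -> Omega}.
Local Notation Ginf := (Ginf P iota).
Local Notation Gam := (@Gam k P Omega iota).
Local Notation coset := (@coset k P Omega iota).
Local Notation Ap := (Ap hP).
Local Notation Fp := {poly %/ P with hP}.
Implicit Types (s t : Ginf).

Lemma coset_unique n (C C' : coset n) s : coset_val C s -> coset_val C' s -> C = C'.
Proof.
move=> Cs C's; apply: val_inj; rewrite /= (coset_reprP C).2 (coset_reprP C').2.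
rewrite (coset_reprP C).2 /= in Cs; rewrite (coset_reprP C').2 /= in C's.
have step (x y u : Ginf) : Gam n (x^-1 * s)%g -> Gam n (y^-1 * s)%g ->
    Gam n (x^-1 * u)%g -> Gam n (y^-1 * u)%g.
  move=> xs ys xu; have -> : (y^-1 * u = (y^-1 * s) * ((x^-1 * s)^-1 * (x^-1 * u)))%g.
    by rewrite invgM invgK !mulgA !mulgK.
  by apply: GamM => //; apply: (GamP P iota n).2.
by apply/seteqP; split=> u; apply: step.
Qed.

Lemma coset_exists n s : Gam 0 s -> exists C : coset n, coset_val C s.
Proof.
move=> s0; have hC : `[< is_coset n [set t | Gam n (s^-1 * t)%g] >].
  by apply/asboolP; exists s.
by exists (MkCoset hC); rewrite /= mulVg; case: (GamP P iota n).
Qed.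

Lemma sum_coset_repr n (f : Ginf -> Ap) (C : coset n) s : coset_val C s ->
  \sum_(C' <- fset_set [set: coset n]) f (coset_repr C') *+ `[< coset_val C' s >] =
  f (coset_repr C).
Proof.
move=> Cs; rewrite (big_fsetD1 C) /=; last first.
  rewrite in_fset_set; first exact: mem_set.
  exact: (finite_coset iota n (P_neq0 hP)).
rewrite asboolT // mulr1n big_seq big1 ?addr0 // => C'.
rewrite in_fsetD1 => /andP[C'C _]; rewrite asboolF // => C's.
by case/eqP: C'C; apply: coset_unique C's Cs.
Qed.

Variable kappa : Ginf -> Ap.
Hypothesis kappa_cycl : is_cyclotomic_char kappa.

Lemma kappa_coset_repr n (C : coset n) s : coset_val C s ->
  adic_close n.+1 (kappa (coset_repr C)) (kappa s).
Proof.
rewrite (coset_reprP C).2 /= => /(Gam_kappa kappa_cycl) h.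
have -> : kappa s = kappa (coset_repr C) * kappa ((coset_repr C)^-1 * s)%g.
  by case: kappa_cycl => <- _ _ _; rewrite mulgA mulgV mul1g.
rewrite -[X in adic_close _ X _]mulr1; apply: congM (cong_refl _ _) _.
exact: cong_sym.
Qed.

(** For a sum of Dirac masses, the Riemann sum of level [n] evaluates the integrand at the
    representative of the coset of each [g i], where [kappa] is close to [kappa (g i)]. Additivity
    of the lift separates the masses. *)
Lemma sinnott_dirac (I : Type) (r : seq I) (D : pred I) (c : I -> Fp)
    (g : I -> Ginf) (l : iwasawa P iota Fp) (y : padic_int p_pr) :
  (forall i, D i -> Gam 0 (g i)) ->
  (forall n (C : coset n),
    iw_coef l n C = \sum_(i <- r | D i) c i *+ `[< coset_val C (g i) >]) ->
  sinnott kappa l y = \sum_(i <- r | D i) lift_Ap (c i) * Ap_pow (kappa (g i)) y.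
Proof.
move=> g0 lE; have [lift liftE] := lift_Ap_morph hP p_char.
apply: adic_limE => N; exists N => n le_Nn.
have -> : \sum_(C \in [set: coset n])
      lift_Ap (iw_coef l n C) * Ap_pow (kappa (coset_repr C)) y =
    \sum_(i <- r | D i) lift_Ap (c i) * \sum_(C <- fset_set [set: coset n])
      Ap_pow (kappa (coset_repr C)) y *+ `[< coset_val C (g i) >].
  rewrite fsbig_finite; last exact: (finite_coset iota n (P_neq0 hP)).
  under [RHS]eq_bigr => i _ do rewrite mulr_sumr.
  rewrite [RHS]exchange_big; apply: eq_bigr => C _ /=.
  rewrite -liftE lE rmorph_sum mulr_suml; apply: eq_bigr => i _ /=.
  by rewrite raddfMn /= liftE mulrnAl mulrnAr.
apply: cong_sum => i Di; have [C Cg] := coset_exists n (g0 i Di).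
rewrite (sum_coset_repr (fun s => Ap_pow (kappa s) y) Cg).
apply: congM (cong_refl _ _) _.
apply: (Ap_pow_cong p_char).
- by apply: kappa_Gam0_one kappa_cycl _ _; case: (coset_reprP C).
- by apply: kappa_Gam0_one kappa_cycl _ _; apply: g0.
- apply: rdvd_exp_le (kappa_coset_repr Cg); exact: leqW.
Qed.

End RiemannSums.

(** * The components of the Artin symbols in [Delta] and in [Gam 0] *)

Section StickelbergerTerms.
Variables (k : finFieldType) (p : nat) (p_pr : prime p) (p_char : p \in [pchar k]).
Variables (P : {poly k}) (hP : monic_irreducible_poly P).
Variables (Omega : closedFieldType).
Variable iota : {rmorphism {fraction {poly k}} -> Omega}.
Local Notation Ginf := (Ginf P iota).
Local Notation Gam := (@Gam k P Omega iota).
Local Notation Ap := (Ap hP).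
Local Notation toFp := (toFp hP).
Local Notation Fp := {poly %/ P with hP}.
Variables (W : comUnitRingType) (redW : {rmorphism W -> Fp}).
Hypothesis W_witt : is_witt_ring p redW.
Variable kappa : Ginf -> Ap.
Hypothesis kappa_cycl : is_cyclotomic_char kappa.
Variable Delta : set Ginf.
Hypothesis Delta_prop : is_Delta Delta.
Implicit Types (a : {poly k}) (s : Ginf).

Lemma Delta_partP s : Delta (Delta_part Delta s) /\ Gam 0 (Gamma_part Delta s).
Proof.
rewrite /Gamma_part /Delta_part; case: xgetP => [t _ []//|no].
have [_ _ _ /(_ s) [d [t [Dd t0 sE]]]] := Delta_prop.
by case: (no d); split=> //; rewrite sE mulgA mulVg mul1g.
Qed.

(** The order of [Delta] is [q ^ d - 1], so [kappa s] is a root of unity and hence the lift of its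
    own residue. *)
Lemma kappa_Delta s : Delta s -> kappa s = lift_Ap (red_Ap (kappa s)).
Proof.
move=> Ds; symmetry; apply: (lift_ApE p_char) => //.
have [[g DE gord] _ _ _] := Delta_prop.
move: Ds; rewrite DE => -[j _ <-]; rewrite card_qfpoly.
have qd : (0 < #|k| ^ (size P).-1)%N by rewrite expn_gt0 ltnW // finNzRing_gt1.
rewrite -[(#|k| ^ _)%N](subnK qd) exprD expr1 -(kappaX kappa_cycl) -expgnA mulnC expgnA.
have -> : (g ^+ (#|k| ^ (size P).-1 - 1) = 1)%g by apply/gord.
by rewrite expg1n (kappa1 kappa_cycl) mul1r.
Qed.

Lemma red_kappa_Gamma s : red_Ap (kappa (Gamma_part Delta s)) = 1.
Proof.
have /(kappa_Gam0_one kappa_cycl)/red_Ap_eq0 := (Delta_partP s).2.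
by rewrite rmorphB rmorph1 => /subr0_eq.
Qed.

Lemma kappa_Delta_Gamma s :
  kappa (Delta_part Delta s) * kappa (Gamma_part Delta s) = kappa s.
Proof.
by case: kappa_cycl => <- _ _ _; rewrite /Gamma_part mulgA mulgV mul1g.
Qed.

Lemma red_kappa_Delta s :
  red_Ap (kappa (Delta_part Delta s)) = red_Ap (kappa s).
Proof. by rewrite -[in RHS]kappa_Delta_Gamma rmorphM /= red_kappa_Gamma mulr1. Qed.

Let p_W : rdvd p%:R (p%:R : W). Proof. by exists 1; rewrite mul1r. Qed.

Lemma red_omega_tilde s i :
  redW (omega_tilde redW kappa s ^- i) = red_Ap (kappa s) ^- i.
Proof.
have [surj ker _ sep compl] := W_witt.
have s0 : red_Ap (kappa s) != 0.
  have : kappa s \is a GRing.unit.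
    by case: kappa_cycl => _ _ kappa_surj _; apply/kappa_surj; exists s.
  by move/(rmorph_unit (@red_Ap k P hP)); rewrite unitfE.
have p_Fp := pchar_residue hP p_char.
have tX := teichX p_pr p_W p_Fp surj ker sep compl s0.
have [_ tr] := teichP p_pr p_W p_Fp surj ker sep compl (red_Ap (kappa s)).
rewrite -/(omega_tilde _ _ _) in tX tr.
(* Invertibility makes [^- i] a genuine inverse in [W], which [redW] then preserves. *)
have tu : omega_tilde redW kappa s \is a GRing.unit.
  rewrite -(unitrX_pos _ (n := #|{: Fp}|.-1)) ?tX ?unitr1 //.
  by rewrite -subn1 subn_gt0 finNzRing_gt1.
by rewrite rmorphV ?unitrX // rmorphXn /= tr.
Qed.

Lemma red_kappa_artinV a : ~~ (P %| a) ->
  red_Ap (kappa (artin kappa a)^-1%g) = (toFp a)^-1.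
Proof.
move=> Pa; rewrite (kappaV kappa_cycl) (kappa_artin kappa_cycl) //.
by rewrite rmorphV ?to_Ap_unit //= red_to_Ap.
Qed.

(** The inverse on the Artin symbol becomes the sign of the exponent: [kappa] sends this component
    to the inverse of [diamond hP a]. *)
Lemma kappa_Gamma_artinV a (y : padic_int p_pr) : ~~ (P %| a) ->
  Ap_pow (kappa (Gamma_part Delta (artin kappa a)^-1%g)) y =
  Ap_pow (diamond hP a) (- y).
Proof.
move=> Pa; set s := ((artin kappa a)^-1)%g; set v := kappa _.
have vu : v * diamond hP a = 1.
  have [lift liftE] := lift_Ap_morph hP p_char.
  have om : omega hP a = lift (toFp a) by rewrite liftE.
  have Dl : kappa (Delta_part Delta s) = (omega hP a)^-1.
    rewrite (kappa_Delta (Delta_partP s).1) red_kappa_Delta red_kappa_artinV //.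
    by rewrite -liftE om fmorphV.
  have := kappa_Delta_Gamma s; rewrite -/v Dl => h.
  rewrite /diamond mulrCA mulrC [v * _]mulrC h.
  by rewrite /s (kappaV kappa_cycl) (kappa_artin kappa_cycl) // mulVr ?to_Ap_unit.
have v1 : red_Ap v = 1 by apply: red_kappa_Gamma.
apply: (Ap_pow_inv p_char _ _ _ vu); apply/red_Ap_eq0; rewrite rmorphB rmorph1 /=.
  have := congr1 (@red_Ap k P hP) vu.
  by rewrite rmorphM rmorph1 /= v1 mul1r => ->; rewrite subrr.
by rewrite v1 subrr.
Qed.

End StickelbergerTerms.

Theorem theorem1p5
  (k : finFieldType) (p : nat) (p_pr : prime p) (p_char : p \in [pchar k])
  (q_ge3 : (3 <= #|k|)%N)
  (P : {poly k}) (hP : monic_irreducible_poly P)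
  (Omega : closedFieldType)
  (iota : {rmorphism {fraction {poly k}} -> Omega})
  (W : comUnitRingType) (redW : {rmorphism W -> {poly %/ P with hP}})
  (W_witt : is_witt_ring p redW)
  (kappa : Ginf P iota -> Ap hP) (kappa_cycl : is_cyclotomic_char kappa)
  (Delta : set (Ginf P iota)) (Delta_prop : is_Delta Delta)
  (Fr : {poly k} -> Ginf P iota)
  (Fr_prop : forall Q, places P Q -> is_frobenius Q (Fr Q))
  (i : nat) (i_le : (i <= #|k| ^ (size P).-1 - 2)%N)
  (y : padic_int p_pr) :
  sinnott_X redW kappa
    (Theta_chi hP Delta Fr (fun s => omega_tilde redW kappa s ^- i)) y
  = Lp hP (- y) i.
Proof.
apply: pseriesP => n /=.
have [lift liftE] := lift_Ap_morph hP p_char.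
pose A (a : {poly_(n.+1) k}) : Ginf P iota := (artin kappa (val a))^-1%g.
pose chi s := omega_tilde redW kappa s ^- i.
(* Each monic [a] of degree [n] prime to [P] contributes a Dirac mass at the second component of its
   inverse Artin symbol, weighted by the reduced character of the first. *)
rewrite (@sinnott_dirac _ _ p_pr p_char _ hP _ _ _ kappa_cycl _
  (index_enum ({poly_(n.+1) k} : finType))
  (fun a : {poly_(n.+1) k} =>
    [&& val a \is monic, size (val a) == n.+1 & ~~ (P %| val a)])
  (fun a => redW (chi (Delta_part Delta (A a))))
  (fun a => Gamma_part Delta (A a))).
- apply: eq_bigr => a /and3P[_ _ Pa]; rewrite kappa_Gamma_artinV //.
  congr (_ * _); rewrite /chi (red_omega_tilde p_pr p_char W_witt kappa_cycl).
  rewrite (red_kappa_Delta kappa_cycl Delta_prop) red_kappa_artinV //.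
  (* The inverse on the Artin symbol cancels the negative exponent of the character, leaving
     [omega hP a ^+ i]. *)
  by rewrite exprVn invrK -liftE rmorphXn liftE.
- by move=> a _; apply: (Delta_partP Delta_prop _).2.
- move=> m C.
  (* [F] gives, on group elements, the linear functional that reads off the coefficient of the twist
     at the coset [C]. *)
  pose F s := chi (Delta_part Delta s) *+ `[< coset_val C (Gamma_part Delta s) >].
  have := malg_sum F (Theta_coef kappa_cycl Fr_prop n).
  move/(congr1 redW); rewrite !rmorph_sum /= => h.
  apply: etrans (etrans h _).
    by rewrite rmorph_sum; apply: eq_bigr => x _; rewrite /F mulrnAr.
  by apply: eq_bigr => a _; rewrite raddfMn.
Qed.
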